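(* Let $n\ge 1$, let $\lambda$ be an $n$-partition, let $\pi\in S_n^\lambda$, and let $T$ be a semistandard tableau of shape $\lambda$. The following are equivalent: (i) $T$ is a Demazure tableau for $\pi$, that is, $R(T)\le Y_\lambda(\pi)$; (ii) $T(l,k)\in A_\lambda(T,\pi;l,k)$ for all $(l,k)\in\lambda$; (iii) $T(l,k)\in B_\lambda(T,\pi;l,k)$ for all $(l,k)\in\lambda$.
   Context: Notation. Fix $n\ge 1$. For integers $p,q$, $[p,q]=\{p,p+1,\dots,q\}$ (empty if $p>q$). An $n$-partition is $\lambda=(\lambda_1\ge\dots\ge\lambda_n\ge 0)$, integers. Its shape has $\lambda_i$ left-justified boxes in row $i$ (row 1 at the top). The box in column $j$ and row $i$ is written $(j,i)\in\lambda$ (column index first). The column lengths are $\zeta_1,\dots,\zeta_{\lambda_1}$. A semistandard tableau $T$ of shape $\lambda$ is a filling with values $T(j,i)\in[1,n]$ such that $T(j,i)\le T(j+1,i)$ and $T(j,i)<T(j,i+1)$; $\mathcal{T}_\lambda$ is the set of these. Boundary conventions: $T(l-1,k):=k$ if $l=1$; $T(l+1,k):=n$ if $l=\lambda_k$; $T(l,k+1):=n+1$ if $k=\zeta_l$. For tableaux of the same shape, $T\le U$ means $T(j,i)\le U(j,i)$ for all boxes. $m(T)$ is the maximum of the values at the bottoms of the columns of $T$ (equivalently the maximum value of $T$); for the empty tableau, $m:=1$. Permutations and keys. $S_n$ is the set of $n$-tuples $\pi=(\pi_1,\dots,\pi_n)$ with distinct entries from $[1,n]$. Let $q_1<\dots<q_r$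 be the distinct column lengths of $\lambda$, $q_0:=0$, $q_{r+1}:=n$. $S_n^\lambda$ is the set of $\pi\in S_n$ such that $\pi_i<\pi_j$ whenever $i<j$ both lie in $[q_{s-1}+1,q_s]$ for some $1\le s\le r+1$. The $\lambda$-key $Y_\lambda(\pi)$ is the tableau of shape $\lambda$ whose $j$th column consists of $\pi_1,\dots,\pi_{\zeta_j}$ sorted increasingly from top to bottom; write $Y_\lambda(\pi;j,i)$ or $Y(j,i)$ for its entries. Right key. For $T\in\mathcal{T}_\lambda$ and each $j$, there is a semistandard skew tableau that rectifies (by jeu de taquin) to $T$, whose column lengths are a rearrangement of $\zeta_1,\dots,\zeta_{\lambda_1}$, and whose rightmost column has length $\zeta_j$; the rightmost column depends only on $T$ and its length $\zeta_j$. The right key $R(T)\in\mathcal{T}_\lambda$ is the tableau whose $j$th column is this rightmost column. Scanning paths. The earliest weakly increasing subsequence (EWIS) of a sequence $(x_1,x_2,\dots)$ is $(x_{i_1},x_{i_2},\dots)$ with $i_1=1$ and, for $j>1$, $i_j$ minimal with $i_j>i_{j-1}$ and $x_{i_{j-1}}\le x_{i_j}$. For $1\le l\le\lambda_1$, let $T^{(l,\zeta_l)}$ be $T$ with its first $l-1$ columns removed (column indexing retained). For $k=\zeta_l,\zeta_l-1,\dots,1$: read the bottom values of the nonempty columns of $T^{(l,k)}$ from left to right (starting with column $l$, whose bottom is at $(l,k)$), take the EWIS of this sequence, and let the scanning path $P(T;l,k)$ be the sequence of locations of this EWIS; then let $T^{(l,k-1)}$ be the (semistandard) tableau obtained from $T^{(l,k)}$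 by removing the boxes of $P(T;l,k)$. Let $U^{(l,k)}$ be $T^{(l,k)}$ with its leftmost remaining column (column $l$) removed. The sets $A$. Write $U=U^{(l,k)}$ and $Y=Y_\lambda(\pi)$. If $m(U)>Y(l,k)$, then $A_\lambda(T,\pi;l,k):=\emptyset$. If $m(U)\le Y(l,k)$, then $A_\lambda(T,\pi;l,k):=[k,\min\{Y(l,k),\,T(l,k+1)-1,\,T(l+1,k)\}]$. The sets $B$. For $(l,k)\in\lambda$ and $j\le l$ there is exactly one $i\in[1,\zeta_j]$ with $(l,k)\in P(T;j,i)$. For $1\le j\le l-1$: let $a(j)$ be the row index with $(l-1,k)\in P(T;j,a(j))$; if $k<\zeta_l$ let $b(j)$ be the row index with $(l,k+1)\in P(T;j,b(j))$, and if $k=\zeta_l$ let $b(j):=\zeta_j+1$. For $a(j)\le i\le b(j)-1$, let $h$ be the largest index less than $l$ such that $(h,r)\in P(T;j,i)$ for some $r$, and set $E(l,k;j,i):=T(h,r)$. For $j=l$ set $a(l):=b(l)-1:=k$ and $E(l,k;l,k):=k$. Then $$B_\lambda(T,\pi;l,k):=\bigcap_{j=1}^{l}\Big(\bigcup_{i=a(j)}^{b(j)-1}[E(l,k;j,i),\,Y_\lambda(\pi;j,i)]\Big).$$ *)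

(* Defs.v *)
From Stdlib Require Import Relations.
From mathcomp Require Import all_boot boolp classical_sets.

Set Implicit Arguments.
Unset Strict Implicit.
Unset Printing Implicit Defensive.

Local Open Scope classical_set_scope.

(* All indices are 1-based, and boxes are written column first: (j, i) is the
   box in column j and row i.  A partition is a nonincreasing sequence of
   naturals, trailing zeros being allowed. *)

Definition is_partition (lam : seq nat) : bool := sorted geq lam.

Definition row_len (lam : seq nat) (i : nat) : nat := nth 0 lam i.-1.

Definition ncols (lam : seq nat) : nat := head 0 lam.

(* zeta_j, for j >= 1 *)
Definition col_len (lam : seq nat) (j : nat) : nat := count (leq j) lam.

Definition col_lens (lam : seq nat) : seq nat :=
  [seq col_len lam j | j <- iota 1 (ncols lam)].

Definition in_shape (lam : seq nat) (j i : nat) : bool :=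
  [&& 0 < i, 0 < j & j <= row_len lam i].

Definition in_skew (mu nu : seq nat) (j i : nat) : bool :=
  in_shape nu j i && ~~ in_shape mu j i.

Definition is_skew_shape (mu nu : seq nat) : Prop :=
  [/\ is_partition mu, is_partition nu &
      forall j i, in_shape mu j i -> in_shape nu j i].

(* A filling of the shape nu / mu is given by a function of the column and row
   indices; its values outside the shape are never used. *)
Definition skew_semistandard (n : nat) (mu nu : seq nat)
    (T : nat -> nat -> nat) : Prop :=
  forall j i, in_skew mu nu j i ->
    [/\ 1 <= T j i <= n,
        in_skew mu nu j.+1 i -> T j i <= T j.+1 i &
        in_skew mu nu j i.+1 -> T j i < T j i.+1].

Definition semistandard (n : nat) (lam : seq nat) (T : nat -> nat -> nat) :=
  skew_semistandard n [::] lam T.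

Definition tab_le (lam : seq nat) (T U : nat -> nat -> nat) : Prop :=
  forall j i, in_shape lam j i -> T j i <= U j i.

Definition is_perm_tuple (n : nat) (p : n.-tuple nat) : bool :=
  uniq p && all (fun x => 1 <= x <= n) p.

(* q_0 = 0, q_1 < ... < q_r, q_{r+1} = n *)
Definition qseq (n : nat) (lam : seq nat) : seq nat :=
  0 :: rcons (sort leq (undup (col_lens lam))) n.

Definition is_lambda_perm (n : nat) (lam : seq nat) (p : n.-tuple nat) : Prop :=
  is_perm_tuple p /\
  forall s i j, 1 <= s < size (qseq n lam) ->
    nth 0 (qseq n lam) s.-1 < i -> i < j -> j <= nth 0 (qseq n lam) s ->
    nth 0 p i.-1 < nth 0 p j.-1.

Definition key (lam p : seq nat) (j i : nat) : nat :=
  nth 0 (sort leq (take (col_len lam j) p)) i.-1.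

Definition filling := nat -> nat -> option nat.

Definition to_filling (mu nu : seq nat) (T : nat -> nat -> nat) : filling :=
  fun j i => if in_skew mu nu j i then Some (T j i) else None.

(* The entry of box b moves to box a, and b becomes empty. *)
Definition move_entry (P : filling) (b a : nat * nat) : filling :=
  fun j i => if (j, i) == a then P b.1 b.2
             else if (j, i) == b then None else P j i.

(* [slide P j i Q]: starting from P with the hole at (j, i), moving the hole
   right or down for as long as possible yields Q.  In case of a tie the lower
   entry moves up. *)
Inductive slide (P : filling) (j i : nat) : filling -> Prop :=
| SlideStop : P j.+1 i = None -> P j i.+1 = None -> slide P j i P
| SlideUp y Q : P j i.+1 = Some y ->
    (forall x, P j.+1 i = Some x -> y <= x) ->
    slide (move_entry P (j, i.+1) (j, i)) j i.+1 Q -> slide P j i Q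
| SlideLeft x Q : P j.+1 i = Some x ->
    (forall y, P j i.+1 = Some y -> x < y) ->
    slide (move_entry P (j.+1, i) (j, i)) j.+1 i Q -> slide P j i Q.

Definition inner_corner (mu : seq nat) (j i : nat) : bool :=
  [&& in_shape mu j i, ~~ in_shape mu j.+1 i & ~~ in_shape mu j i.+1].

Definition jdt_slide (P Q : filling) : Prop :=
  exists mu nu j i,
    [/\ is_skew_shape mu nu,
        forall j' i', isSome (P j' i') = in_skew mu nu j' i',
        inner_corner mu j i & slide P j i Q].

(* To be used when Q has a straight shape. *)
Definition rectifies (P Q : filling) : Prop :=
  clos_refl_trans filling jdt_slide P Q.

Definition skew_col_len (mu nu : seq nat) (j : nat) : nat :=
  col_len nu j - col_len mu j.

Definition skew_col_lens (mu nu : seq nat) : seq nat :=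
  [seq skew_col_len mu nu j | j <- iota 1 (ncols nu)].

Definition rightmost_col (mu nu : seq nat) (S : nat -> nat -> nat) : seq nat :=
  [seq S (ncols nu) i | i <- iota (col_len mu (ncols nu)).+1
                                  (skew_col_len mu nu (ncols nu))].

(* The possible rightmost columns of length zeta_j; this set is a singleton
   when T is semistandard and 1 <= j <= lambda_1. *)
Definition right_key_cols (n : nat) (lam : seq nat) (T : nat -> nat -> nat)
    (j : nat) : set (seq nat) :=
  [set c | exists mu nu S,
    [/\ is_skew_shape mu nu, skew_semistandard n mu nu S,
        rectifies (to_filling mu nu S) (to_filling [::] lam T) &
        [/\ perm_eq (skew_col_lens mu nu) (col_lens lam),
            skew_col_len mu nu (ncols nu) = col_len lam j &
            c = rightmost_col mu nu S]]].

Definition right_key (n : nat) (lam : seq nat) (T : nat -> nat -> nat)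
    (j i : nat) : nat :=
  nth 0 (xget [::] (right_key_cols n lam T j)) i.-1.

Definition is_demazure (n : nat) (lam p : seq nat) (T : nat -> nat -> nat) :=
  tab_le lam (right_key n lam T) (key lam p).

Fixpoint ewis_from (A : Type) (v : A -> nat) (x : A) (s : seq A) : seq A :=
  if s is y :: s' then
    if v x <= v y then y :: ewis_from v y s' else ewis_from v x s'
  else [::].

(* The members of s whose values under v form the EWIS of [seq v x | x <- s]. *)
Definition ewis (A : Type) (v : A -> nat) (s : seq A) : seq A :=
  if s is x :: s' then x :: ewis_from v x s' else [::].

(* Scanning only ever removes boxes from the bottoms of columns, so each
   intermediate tableau consists of T and the function h giving the numbers of
   boxes left in its columns. *)
Definition bottoms (lam : seq nat) (h : nat -> nat) : seq (nat * nat) :=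
  [seq (j, h j) | j <- iota 1 (ncols lam) & 0 < h j].

Definition scan (lam : seq nat) (T : nat -> nat -> nat) (h : nat -> nat) :
    seq (nat * nat) :=
  ewis (fun b => T b.1 b.2) (bottoms lam h).

Fixpoint scan_heights (lam : seq nat) (T : nat -> nat -> nat) (l t : nat) :
    nat -> nat :=
  if t is t'.+1 then
    let h := scan_heights lam T l t' in
    fun j => h j - ((j, h j) \in scan lam T h)
  else fun j => if j < l then 0 else col_len lam j.

(* The column heights of T^(l,k). *)
Definition heights (lam : seq nat) (T : nat -> nat -> nat) (l k : nat) :=
  scan_heights lam T l (col_len lam l - k).

Definition scan_path (lam : seq nat) (T : nat -> nat -> nat) (l k : nat) :
    seq (nat * nat) :=
  scan lam T (heights lam T l k).

(* The initial value 1 is m of the empty tableau; the values of a tableau are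
   at least 1, so it is otherwise harmless. *)
Definition maxval (lam : seq nat) (T : nat -> nat -> nat) (h : nat -> nat) :=
  \big[maxn/1]_(b <- bottoms lam h) T b.1 b.2.

(* The column heights of U^(l,k). *)
Definition Uheights (lam : seq nat) (T : nat -> nat -> nat) (l k : nat) :
    nat -> nat :=
  fun j => if j == l then 0 else heights lam T l k j.

(* T(l+1, k) and T(l, k+1) with their boundary conventions. *)
Definition right_entry (n : nat) (lam : seq nat) (T : nat -> nat -> nat)
    (l k : nat) : nat :=
  if l == row_len lam k then n else T l.+1 k.

Definition below_entry (n : nat) (lam : seq nat) (T : nat -> nat -> nat)
    (l k : nat) : nat :=
  if k == col_len lam l then n.+1 else T l k.+1.

Definition Aset (n : nat) (lam p : seq nat) (T : nat -> nat -> nat)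
    (l k : nat) : set nat :=
  if maxval lam T (Uheights lam T l k) <= key lam p l k then
    [set x | k <= x <= minn (key lam p l k)
                         (minn (below_entry n lam T l k).-1
                               (right_entry n lam T l k))]
  else set0.

(* The (unique) row index i in [1, zeta_j] with b on the path P(T; j, i). *)
Definition path_row (lam : seq nat) (T : nat -> nat -> nat) (j : nat)
    (b : nat * nat) : nat :=
  head 0 [seq i <- iota 1 (col_len lam j) | b \in scan_path lam T j i].

Definition arow (lam : seq nat) (T : nat -> nat -> nat) (l k j : nat) : nat :=
  if j == l then k else path_row lam T j (l.-1, k).

Definition brow (lam : seq nat) (T : nat -> nat -> nat) (l k j : nat) : nat :=
  if j == l then k.+1
  else if k < col_len lam l then path_row lam T j (l, k.+1)
  else (col_len lam j).+1.

(* Paths are listed by increasing columns, so the box (h, r) is the last one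
   of the path in a column before l. *)
Definition Eval (lam : seq nat) (T : nat -> nat -> nat) (l k j i : nat) : nat :=
  if j == l then k
  else let b := last (0, 0) [seq b <- scan_path lam T j i | b.1 < l] in
       T b.1 b.2.

Definition Bset (lam p : seq nat) (T : nat -> nat -> nat)
    (l k : nat) : set nat :=
  \bigcap_(j in [set j | 1 <= j <= l])
    \bigcup_(i in [set i | arow lam T l k j <= i < brow lam T l k j])
      [set x | Eval lam T l k j i <= x <= key lam p j i].

(* Main.v *)
Require Import Defs.
From Stdlib Require Import Relations.
From mathcomp Require Import all_boot boolp classical_sets.
From mathcomp Require Import zify.

Set Implicit Arguments.
Unset Strict Implicit.
Unset Printing Implicit Defensive.

(** Record a (skew) tableau by the sets of entries of its columns: a matrix
    [M] with [M j v] true when [v] occurs in column [j].  For adjacent columns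
    [A] and [B] let g(t) be the number of entries at most t in [B] minus the
    number of those in [A]; the two columns fit together as a tableau of
    straight shape exactly when g is nowhere positive.  Otherwise the raising
    move takes the first t at which g is maximal out of [B] and puts it into
    [A].  This is a crystal operator acting on columns instead of letters, and
    four facts about it give the right key.

    A jeu de taquin slide is a sequence of raising moves: only the horizontal
    steps of the hole change the column sets, and counting row by row shows
    that the entry which crosses is the one that the raising move selects
    ([raising_left], [slide_raises]).

    Raising moves are confluent ([highest_unique]), so all ways of rectifying
    lead to the same tableau.  By Newman's argument only two moves on three
    consecutive columns matter.  There the longest strictly decreasing
    subsequence of the column word, restricted to the values up to v, has
    invariant length; when no move is left it counts the entries up to v of
    the first column.  Complementing the columns and reversing their order
    does the same for the third column, and the content gives the middle one
    ([three_columns]).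

    A skew tableau whose column lengths rearrange those of its rectification T
    is extremal.  Whenever a column is shorter than the next one, raising moves
    exchange the two lengths; once the lengths decrease they are those of T,
    and no move can be left.  Since each raising move can be undone, the matrix
    is determined by its column lengths ([extremal_unique]), and sorting all
    columns but the last shows that the last column depends only on its length
    ([last_column_unique]).

    Scanning computes such a matrix.  Followed column by column rather than
    path by path, the paths that start in column l exchange column l with
    column l+1, then with column l+2, and so on; each exchange is a sequence of
    raising moves read backwards ([exchange]).  Hence the entry of the right key
    at (l, k) is the value at the end of the path P(T; l, k) ([right_keyE]).

    Condition (i) therefore says that P(T; j, i) ends with a value at most
    Y(j, i).  The last value of an EWIS is the maximum of the sequence, here the
    larger of T(l, k) and m(U), and this is (ii).  If (i) holds then, for each j,
    the path from column j through (l, k) is an index that (iii) asks for.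
    Conversely apply (iii) to the last box (l, k) of P(T; j, i): an index i' > i
    is impossible, because the path P(T; j, i'), scanned earlier, would have
    found (l, k) at the bottom of column l with a large enough value and used
    it; and for i' <= i the bound Y(j, i') is at most Y(j, i). *)

(** * Columns as sets of values *)

Definition cnt (A : nat -> bool) (t : nat) : nat := count A (iota 1 t).

Lemma cnt0 A : cnt A 0 = 0. Proof. by []. Qed.

Lemma iota_rcons a p : iota a p.+1 = rcons (iota a p) (a + p).
Proof. by elim: p a => [|p IH] a; rewrite ?addn0 // -addSnnS /= -IH. Qed.

Lemma cntS A t : cnt A t.+1 = cnt A t + A t.+1.
Proof. by rewrite /cnt iota_rcons -cats1 count_cat /= addn0. Qed.

Lemma cnt_mono A s t : s <= t -> cnt A s <= cnt A t.
Proof.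
move=> /subnKC <-; elim: (t - s) => [|k IH]; first by rewrite addn0.
by rewrite addnS cntS; lia.
Qed.

Lemma cnt_pred A b : 0 < b -> cnt A b = cnt A b.-1 + A b.
Proof. by case: b => // b _; rewrite cntS. Qed.

Lemma eq_cnt A B : (forall t, cnt A t = cnt B t) -> A 0 = B 0 -> A = B.
Proof.
move=> h h0; apply/funext=> -[//|v].
by move: (h v.+1); rewrite !cntS h => /addnI; case: (A _) (B _) => [] [].
Qed.

Definition compl (A : nat -> bool) : nat -> bool := fun v => ~~ A v.

Lemma cnt_compl A t : cnt (compl A) t + cnt A t = t.
Proof. by elim: t => // t IH; rewrite !cntS; rewrite {2}/compl; case: (A _) => /=; lia. Qed.

Definition add_val (A : nat -> bool) (b : nat) : nat -> bool :=
  fun v => A v || (v == b).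

Definition rem_val (B : nat -> bool) (b : nat) : nat -> bool :=
  fun v => B v && (v != b).

Lemma cnt_add (A : nat -> bool) b t : 0 < b -> ~~ A b -> cnt (add_val A b) t = cnt A t + (b <= t).
Proof.
move=> b0 nAb; elim: t => [|t IH]; first by rewrite leqNgt b0.
rewrite !cntS IH /add_val; case: (ltngtP b t.+1) => h.
- have -> : (b <= t) = true by lia.
  by case: (A _) => /=; lia.
- have -> : (b <= t) = false by lia.
  by case: (A _) => /=; lia.
- rewrite -h (negPf nAb) /=; have -> : (b <= t) = false by lia.
  lia.
Qed.

Lemma cnt_rem (B : nat -> bool) b t : 0 < b -> B b -> cnt (rem_val B b) t + (b <= t) = cnt B t.
Proof.
move=> b0 Bb; elim: t => [|t IH]; first by rewrite leqNgt b0.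
rewrite !cntS -IH /rem_val; case: (ltngtP b t.+1) => h.
- have -> : (b <= t) = true by lia.
  by case: (B _) => /=; lia.
- have -> : (b <= t) = false by lia.
  by case: (B _) => /=; lia.
- rewrite -h Bb /=; have -> : (b <= t) = false by lia.
  lia.
Qed.

(** * Moving one value between adjacent columns *)

(** The third clause makes [b] a maximum of the difference of the counts, the
    second one makes it the first: [b] is the last letter of [B] left unmatched
    when each entry of [B] is bracketed with an entry of [A] not exceeding it. *)
Definition raising (A B : nat -> bool) (b : nat) : Prop :=
  [/\ 0 < b, forall t, t < b -> cnt B t + cnt A b < cnt B b + cnt A t
    & forall t, cnt B t + cnt A b <= cnt B b + cnt A t].

Lemma raising_mem A B b : raising A B b -> B b /\ ~~ A b.
Proof.
case=> b0 h _; have := h b.-1; rewrite (cnt_pred A b0) (cnt_pred B b0).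
by case: (A b) (B b) => [] [] //=; lia.
Qed.

Lemma raising_pred A B b : raising A B b ->
  cnt B b = (cnt B b.-1).+1 /\ cnt A b = cnt A b.-1.
Proof.
move=> h; have [Bb nAb] := raising_mem h; case: h => b0 _ _.
by rewrite (cnt_pred A b0) (cnt_pred B b0) Bb (negPf nAb) /=; lia.
Qed.

(** The difference of the counts does not change when both columns are
    complemented and exchanged.  This duality turns statements about the first
    of several columns into statements about the last. *)
Lemma raising_compl A B b : raising A B b -> raising (compl B) (compl A) b.
Proof.
case=> b0 h1 h2; split=> // t; last first.
  have := h2 t; have := cnt_compl A t; have := cnt_compl A b.
  by have := cnt_compl B t; have := cnt_compl B b; lia.
move=> /h1; have := cnt_compl A t; have := cnt_compl A b.
by have := cnt_compl B t; have := cnt_compl B b; lia.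
Qed.

Lemma compl_add A b : compl (add_val A b) = rem_val (compl A) b.
Proof. by apply/funext=> v; rewrite /compl /add_val /rem_val negb_or. Qed.

Lemma compl_rem A b : compl (rem_val A b) = add_val (compl A) b.
Proof. by apply/funext=> v; rewrite /compl /add_val /rem_val negb_and negbK. Qed.

Lemma cnt_const (A : nat -> bool) n t : (forall v, A v -> v <= n) -> n <= t -> cnt A t = cnt A n.
Proof.
move=> hA /subnKC <-; elim: (t - n) => [|k IH]; first by rewrite addn0.
rewrite addnS cntS IH; case E: (A _) => /=; last by rewrite addn0.
by have := hA _ E; lia.
Qed.

Lemma raising_ex n (A B : nat -> bool) t : (forall v, A v -> v <= n) -> (forall v, B v -> v <= n) ->
  cnt A t < cnt B t -> exists b, raising A B b.
Proof.
move=> hA hB hlt.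
have red u : exists2 w, w <= n & cnt A u = cnt A w /\ cnt B u = cnt B w.
  case: (leqP u n) => h; first by exists u.
  by exists n => //; rewrite !(@cnt_const _ n u) //; lia.
pose Q d := has (fun u => cnt B u == cnt A u + d) (iota 0 n.+1).
have hQ u d : cnt B u = cnt A u + d -> Q d.
  have [w wn [-> ->]] := red u => e; apply/hasP; exists w; last by apply/eqP.
  by rewrite mem_iota; lia.
have ubQ d : Q d -> d <= cnt B n.
  case/hasP=> u; rewrite mem_iota => hu /eqP e.
  by have := @cnt_mono B u n; lia.
have exQ : exists d, Q d by exists (cnt B t - cnt A t); apply: (hQ t); lia.
pose d := ex_maxn exQ ubQ; have := erefl d; rewrite {2}/d; case: ex_maxnP => d' Qd' md' _.
have mx u : cnt B u <= cnt A u + d'.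
  case: (leqP (cnt B u) (cnt A u)) => h; first lia.
  by have := md' (cnt B u - cnt A u) (hQ u _ _); lia.
have d0 : 0 < d' by have := md' (cnt B t - cnt A t) (hQ t _ _); lia.
have exb : exists u, cnt B u == cnt A u + d' by case/hasP: Qd' => u _ h; exists u.
case: (ex_minnP exb) => b /eqP hb mb; exists b; split.
- by case: b hb {mb} => //; rewrite !cnt0; lia.
- move=> u hu; have := mx u; have := mb u; case: eqP => [_ /(_ isT)|]; lia.
- by move=> u; have := mx u; lia.
Qed.

(** Undoing the move: after it, [b - 1] is the last place where the difference
    of the counts is maximal, so the new pair of columns remembers [b]. *)
Lemma raising_inj A B A' B' b b' : raising A B b -> raising A' B' b' ->
  add_val A b = add_val A' b' -> rem_val B b = rem_val B' b' -> b = b'.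
Proof.
wlog: A B A' B' b b' / b <= b'.
  move=> W h h' eA eB; case: (leqP b b') => [hb|/ltnW hb]; first exact: (W A B A' B').
  by symmetry; apply: (W A' B' A B).
move=> leb h h' eA eB; case: (ltngtP b b') => [ltb||//]; last lia.
have [Bb Ab] := raising_mem h; have [Bb' Ab'] := raising_mem h'.
have [pB' pA'] := raising_pred h'.
case: h h' => b0 h1 h2 [b0' h1' h2'].
have eqA t : cnt A t + (b <= t) = cnt A' t + (b' <= t).
  by rewrite -cnt_add // eA cnt_add.
have eqB t : cnt B t + (b' <= t) = cnt B' t + (b <= t).
  by rewrite -(@cnt_rem B b) // -(@cnt_rem B' b') // eB; lia.
have [pB pA] : cnt B b = (cnt B b.-1).+1 /\ cnt A b = cnt A b.-1.
  by apply: raising_pred.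
have := h2 b'.-1; have := h1' b; have := h1' b.-1; have := h2' b; have := h2' b.-1.
have := eqA b; have := eqA b.-1; have := eqA b'; have := eqA b'.-1.
have := eqB b; have := eqB b.-1; have := eqB b'; have := eqB b'.-1.
lia.
Qed.


(** * Matrices of columns *)

Notation matrix := (nat -> nat -> bool).

Definition move_val (j b : nat) (M : matrix) : matrix := fun k =>
  if k == j then add_val (M j) b
  else if k == j.+1 then rem_val (M j.+1) b else M k.

Lemma move_val_l j b M : move_val j b M j = add_val (M j) b.
Proof. by rewrite /move_val eqxx. Qed.

Lemma move_val_r j b M : move_val j b M j.+1 = rem_val (M j.+1) b.
Proof. by rewrite /move_val eqn_leq ltnn eqxx. Qed.

Lemma move_val_out j b M k : k != j -> k != j.+1 -> move_val j b M k = M k.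
Proof. by rewrite /move_val => /negPf -> /negPf ->. Qed.

(** The restriction [J] on the column indices keeps track of the columns that
    stay untouched. *)
Inductive raises (J : nat -> bool) : matrix -> matrix -> Prop :=
| raises0 M : raises J M M
| raisesS j b M N : J j -> 0 < j -> raising (M j) (M j.+1) b ->
    raises J (move_val j b M) N -> raises J M N.

Lemma raises_trans (J : nat -> bool) M N P : raises J M N -> raises J N P -> raises J M P.
Proof. by elim=> // j b {}M {}N hj j0 hb _ IH /IH; apply: raisesS. Qed.

Lemma raises1 (J : nat -> bool) (M : matrix) j b : J j -> 0 < j -> raising (M j) (M j.+1) b ->
  raises J M (move_val j b M).
Proof. by move=> hj j0 hb; apply: (raisesS hj j0 hb); apply: raises0. Qed.

Lemma raises_inv (J : nat -> bool) M N : raises J M N -> N = M \/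
  exists j b, [/\ J j, 0 < j, raising (M j) (M j.+1) b & raises J (move_val j b M) N].
Proof. by case=> [{}M|j b {}M {}N hj j0 hb h]; [left|right; exists j, b]. Qed.

Lemma raises_sub (J K : nat -> bool) M N : (forall j, J j -> K j) ->
  raises J M N -> raises K M N.
Proof.
by move=> h; elim=> [{}M|j b {}M {}N /h hj j0 hb _]; [apply: raises0|apply: raisesS].
Qed.

Lemma raises_out (J : nat -> bool) M N k : raises J M N -> ~~ J k -> ~~ J k.-1 -> N k = M k.
Proof.
elim=> // j b {}M {}N hj j0 hb _ IH hk hk'; rewrite IH // move_val_out //.
  by apply: contraNneq hk => ->.
by apply: contraNneq hk' => ->.
Qed.

Definition supported (m n : nat) (M : matrix) : Prop :=
  forall j v, M j v -> (0 < j <= m) && (0 < v <= n).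

Lemma supported_move m n j b (M : matrix) : supported m n M -> 0 < j ->
  raising (M j) (M j.+1) b -> supported m n (move_val j b M).
Proof.
move=> hM j0 /raising_mem[hb _] k v; rewrite /move_val.
have := hM _ _ hb; case: eqP => [->|_] h; last first.
  by case: eqP => [->|_]; [case/andP=> /hM|apply: hM].
by case/orP=> [/hM //|/eqP ->]; lia.
Qed.

Lemma supported_raises m n J M N : supported m n M -> raises J M N -> supported m n N.
Proof.
by move=> hM h; elim: h hM => // j b {}M {}N _ j0 hb _ IH hM; apply: IH; apply: supported_move.
Qed.

(** No raising move applies; for all indices this characterizes the columns of
    a tableau of straight shape. *)
Definition highest (J : nat -> bool) (M : matrix) : Prop :=
  forall j t, J j -> 0 < j -> cnt (M j.+1) t <= cnt (M j) t.

Lemma sum_delta (N a : nat) (F : nat -> nat) : a < N ->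
  \sum_(i < N) F i * (i == a :> nat) = F a.
Proof.
move=> aN; rewrite (bigD1 (Ordinal aN)) //= eqxx muln1 big1 ?addn0 // => i.
by rewrite -val_eqE /= => /negPf ->; rewrite muln0.
Qed.

Definition weight (n : nat) (M : matrix) (j : nat) : nat := cnt (M j) n.

(** Every raising move lowers this by one, which bounds all sequences. *)
Definition potential (m n : nat) (M : matrix) : nat :=
  \sum_(j < m.+1) j * weight n M j.

Lemma weight_move m n (M : matrix) j b k : supported m n M -> 0 < j ->
  raising (M j) (M j.+1) b ->
  weight n (move_val j b M) k + (k == j.+1) = weight n M k + (k == j).
Proof.
move=> hM j0 h; have [Bb Ab] := raising_mem h; case: (h) => b0 _ _.
have bn : b <= n by have := hM _ _ Bb; lia.
rewrite /weight; case: (eqVneq k j) => [->|kj].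
  rewrite move_val_l cnt_add // bn; have -> : (j == j.+1) = false by lia.
  by rewrite addn0.
case: (eqVneq k j.+1) => [->|kj1]; last by rewrite move_val_out.
by rewrite move_val_r addn0 -(cnt_rem n b0 Bb) bn.
Qed.

Lemma potential_move m n (M : matrix) j b : supported m n M -> 0 < j ->
  raising (M j) (M j.+1) b ->
  potential m n (move_val j b M) < potential m n M.
Proof.
move=> hM j0 h; have [Bb Ab] := raising_mem h.
have jm : j.+1 <= m by have := hM _ _ Bb; lia.
have e : potential m n (move_val j b M) + j.+1 = potential m n M + j.
  have e1 : \sum_(i < m.+1) i * (i == j :> nat) = j by apply: (@sum_delta m.+1 j id); lia.
  have e2 : \sum_(i < m.+1) i * (i == j.+1 :> nat) = j.+1 by exact: (@sum_delta m.+1 j.+1 id).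
  rewrite -[X in _ + X = _]e2 -[X in _ = _ + X]e1.
  rewrite -!big_split /=; apply: eq_bigr => k _; rewrite -!mulnDr.
  by rewrite (weight_move k hM j0 h).
lia.
Qed.

Lemma potential_raises m n J M N : supported m n M -> raises J M N ->
  potential m n N <= potential m n M /\
  (potential m n N = potential m n M -> N = M).
Proof.
move=> hM h; elim: h hM => // j b {}M {}N _ j0 hb hr IH hM.
have hM' := supported_move hM j0 hb; have [h1 h2] := IH hM'.
have := potential_move hM j0 hb.
by split=> [|e]; lia.
Qed.

Lemma raises_highest m n J M : supported m n M ->
  exists2 N, raises J M N & highest J N.
Proof.
have [k] := ubnP (potential m n M); elim: k M => // k IH M hk hM.
have [h|h] := pselect (highest J M); first by exists M => //; apply: raises0.
have [j [t [hj j0 ht]]] : exists j t, [/\ J j, 0 < j & cnt (M j) t < cnt (M j.+1) t].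
  apply: contrapT => hn; apply: h => j t hj j0; rewrite leqNgt; apply/negP => ht.
  by apply: hn; exists j, t.
have bd i v : M i v -> v <= n by move=> /hM; lia.
have [b hb] := raising_ex (bd j) (bd j.+1) ht.
have := potential_move hM j0 hb => hp.
have [//||N hN hh] := IH (move_val j b M); first lia; first exact: supported_move.
by exists N => //; apply: raisesS hb hN.
Qed.

(** * Three columns *)

(** A decreasing subsequence of the column word uses the values in ]t1, v] of
    [A], those in ]t2, t1] of [B] and those up to t2 of [C]; so this bounds the
    longest one by [x]. *)
Definition chain_le (A B C : nat -> bool) (v x : nat) : Prop :=
  forall t1 t2, t2 <= t1 -> t1 <= v ->
    cnt A v + cnt B t1 + cnt C t2 <= x + cnt A t1 + cnt B t2.

(** With the other data fixed, a chain is measured by the difference of the counts of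
    [A] and [B] at [t1], up to a constant.  If the moved value lies in the
    window, the optimum passes from [b] to [b.-1], where the difference is one
    smaller, and the entry gained by [A] makes up for it. *)
Lemma chain_le_raise12 (A B C : nat -> bool) b v x : raising A B b ->
  chain_le (add_val A b) (rem_val B b) C v x <-> chain_le A B C v x.
Proof.
move=> h; have [Bb Ab] := raising_mem h; have [pB pA] := raising_pred h.
case: h => b0 h1 h2.
have eA t := cnt_add t b0 Ab; have eB t := cnt_rem t b0 Bb.
split=> H t1 t2 ht1 ht2.
- have [hb|hb] := boolP (t2 < b <= v); last first.
    have := H t1 t2 ht1 ht2; rewrite !eA.
    by have := eB t1; have := eB t2; lia.
  have := H b.-1 t2; rewrite !eA => /(_ _ _).
  have := eB b.-1; have := eB t2; have := h2 t1; lia.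
- have [hb|hb] := boolP (t2 < b <= v); last first.
    have := H t1 t2 ht1 ht2; rewrite !eA.
    by have := eB t1; have := eB t2; lia.
  have := H b t2; rewrite !eA => /(_ _ _).
  have := eB t1; have := eB t2; have := h2 t1; have := h1 t1; lia.
Qed.

Lemma chain_le_raise23 (A B C : nat -> bool) b v x : raising B C b ->
  chain_le A (add_val B b) (rem_val C b) v x <-> chain_le A B C v x.
Proof.
move=> h; have [Bb Ab] := raising_mem h; have [pB pA] := raising_pred h.
case: h => b0 h1 h2.
have eA t := cnt_add t b0 Ab; have eB t := cnt_rem t b0 Bb.
split=> H t1 t2 ht1 ht2.
- have [hb|hb] := boolP (b <= t1); last first.
    have := H t1 t2 ht1 ht2; rewrite !eA.
    by have := eB t1; have := eB t2; lia.
  have := H t1 b.-1; rewrite !eA => /(_ _ _).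
  have := eB b.-1; have := eB t2; have := h2 t2; lia.
- have [hb|hb] := boolP (b <= t1); last first.
    have := H t1 t2 ht1 ht2; rewrite !eA.
    by have := eB t1; have := eB t2; lia.
  have := H t1 b; rewrite !eA => /(_ _ _).
  have := eB t1; have := eB t2; have := h2 t2; have := h1 t2; lia.
Qed.

Definition pair_at (j : nat) : nat -> bool := fun i => (i == j) || (i == j.+1).

Lemma chain_le_raises j M N v x : raises (pair_at j) M N ->
  chain_le (N j) (N j.+1) (N j.+2) v x <-> chain_le (M j) (M j.+1) (M j.+2) v x.
Proof.
elim=> // i b {}M {}N /orP[]/eqP -> i0 hb _ ->.
  rewrite move_val_l move_val_r move_val_out ?chain_le_raise12 //; lia.
by rewrite move_val_l move_val_r move_val_out ?chain_le_raise23 //; lia.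
Qed.

Lemma chain_le_compl_raises j M N v x : raises (pair_at j) M N ->
  chain_le (compl (N j.+2)) (compl (N j.+1)) (compl (N j)) v x <->
  chain_le (compl (M j.+2)) (compl (M j.+1)) (compl (M j)) v x.
Proof.
elim=> // i b {}M {}N /orP[]/eqP -> i0 /raising_compl hb _ ->.
  rewrite move_val_l move_val_r move_val_out ?compl_add ?compl_rem ?chain_le_raise23 //; lia.
by rewrite move_val_l move_val_r move_val_out ?compl_add ?compl_rem ?chain_le_raise12 //; lia.
Qed.

Lemma chain_le_highest (A B C : nat -> bool) v x :
  (forall t, cnt B t <= cnt A t) -> (forall t, cnt C t <= cnt B t) ->
  chain_le A B C v x <-> cnt A v <= x.
Proof.
move=> h1 h2; split=> [/(_ 0 0 isT isT)|hx t1 t2 _ _].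
  by rewrite !cnt0 !addn0.
by have := h1 t1; have := h2 t2; lia.
Qed.

Lemma cnt_content_raises j M N t : raises (pair_at j) M N ->
  cnt (N j) t + cnt (N j.+1) t + cnt (N j.+2) t =
  cnt (M j) t + cnt (M j.+1) t + cnt (M j.+2) t.
Proof.
elim=> // i b {}M {}N hi i0 hb _ ->.
have [Bb Ab] := raising_mem hb; case: hb => b0 _ _.
have := cnt_add t b0 Ab; have := cnt_rem t b0 Bb.
case/orP: hi Bb Ab => /eqP -> _ _.
  rewrite move_val_l move_val_r move_val_out; lia.
rewrite move_val_l move_val_r move_val_out; lia.
Qed.

(** Confluence for three columns.  Chain lengths of the columns and of their
    complements are invariant and give the two outer columns of a highest
    matrix; the number of occurrences of each value then gives the middle one. *)
Lemma three_columns m n j M N N' : supported m n M -> 0 < j ->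
  raises (pair_at j) M N -> raises (pair_at j) M N' ->
  highest (pair_at j) N -> highest (pair_at j) N' -> N = N'.
Proof.
move=> hM j0 hN hN' H H'.
have sN := supported_raises hM hN; have sN' := supported_raises hM hN'.
have Jj : pair_at j j by rewrite /pair_at eqxx.
have Jj1 : pair_at j j.+1 by rewrite /pair_at eqxx orbT.
have eq_le a b : (forall x, a <= x <-> b <= x) -> a = b.
  by move=> h; have := (h a).1 (leqnn a); have := (h b).2 (leqnn b); lia.
have e1 t : cnt (N j) t = cnt (N' j) t.
  apply: eq_le => x.
  rewrite -(chain_le_highest _ _ (fun t => H j t Jj j0) (fun t => H j.+1 t Jj1 isT)).
  rewrite -(chain_le_highest _ _ (fun t => H' j t Jj j0) (fun t => H' j.+1 t Jj1 isT)).
  by rewrite (chain_le_raises _ _ hN) (chain_le_raises _ _ hN').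
have cl (A B : nat -> bool) t : cnt A t <= cnt B t -> cnt (compl B) t <= cnt (compl A) t.
  by have := cnt_compl A t; have := cnt_compl B t; lia.
have e3 t : cnt (N j.+2) t = cnt (N' j.+2) t.
  have : cnt (compl (N j.+2)) t = cnt (compl (N' j.+2)) t.
    apply: eq_le => x.
    rewrite -(chain_le_highest _ _ (fun t => cl _ _ t (H j.+1 t Jj1 isT)) (fun t => cl _ _ t (H j t Jj j0))).
    rewrite -(chain_le_highest _ _ (fun t => cl _ _ t (H' j.+1 t Jj1 isT)) (fun t => cl _ _ t (H' j t Jj j0))).
    by rewrite (chain_le_compl_raises _ _ hN) (chain_le_compl_raises _ _ hN').
  by have := cnt_compl (N j.+2) t; have := cnt_compl (N' j.+2) t; lia.
have e2 t : cnt (N j.+1) t = cnt (N' j.+1) t.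
  have := cnt_content_raises t hN; have := cnt_content_raises t hN'.
  by have := e1 t; have := e3 t; lia.
have z i : N i 0 = N' i 0.
  by apply/idP/idP=> [/sN|/sN']; rewrite andbF.
apply/funext => i.
case: (eqVneq i j) => [->|i1]; first exact: eq_cnt.
case: (eqVneq i j.+1) => [->|i2]; first exact: eq_cnt.
case: (eqVneq i j.+2) => [->|i3]; first exact: eq_cnt.
have o1 : ~~ pair_at j i by rewrite /pair_at; lia.
have [->|ni] := eqVneq i 0.
  apply/funext=> v; apply/idP/idP=> [/sN|/sN'] //.
have o2 : ~~ pair_at j i.-1 by rewrite /pair_at; lia.
by rewrite (raises_out hN) // (raises_out hN').
Qed.

(** * Confluence *)

Definition everywhere : nat -> bool := fun _ => true.

Lemma raising_unique A B b b' : raising A B b -> raising A B b' -> b = b'.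
Proof.
case=> _ h1 h2 [_ h1' h2']; case: (ltngtP b b') => // h.
  by have := h1' _ h; have := h2 b'; lia.
by have := h1 _ h; have := h2' b; lia.
Qed.

Lemma move_val_comm (M : matrix) i b j c : i.+1 < j ->
  move_val j c (move_val i b M) = move_val i b (move_val j c M).
Proof.
move=> ij; apply/funext=> k.
case: (eqVneq k i) => [->|ki].
  by rewrite move_val_out ?move_val_l ?move_val_out //; lia.
case: (eqVneq k i.+1) => [->|ki1].
  by rewrite move_val_out ?move_val_r ?move_val_out //; lia.
rewrite [RHS]move_val_out //.
case: (eqVneq k j) => [->|kj]; first by rewrite !move_val_l move_val_out //; lia.
case: (eqVneq k j.+1) => [->|kj1]; first by rewrite !move_val_r move_val_out //; lia.
by rewrite !move_val_out.
Qed.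

(** Moves that share no column commute; moves on overlapping pairs meet in the
    common highest matrix of their three columns. *)
Lemma local_confluence m n (M : matrix) i b j c : supported m n M ->
  0 < i -> 0 < j -> raising (M i) (M i.+1) b -> raising (M j) (M j.+1) c ->
  exists2 N, raises everywhere (move_val i b M) N & raises everywhere (move_val j c M) N.
Proof.
wlog ij : i b j c / i <= j.
  move=> W hM i0 j0 hi hj; have [h|/ltnW h] := leqP i j; first exact: W.
  by have [N ? ?] := W j c i b h hM j0 i0 hj hi; exists N.
move=> hM i0 j0 hi hj.
have [e|nij] := eqVneq i j.
  rewrite -e in hj *; rewrite (raising_unique hi hj).
  by exists (move_val i c M); apply: raises0.
have [e|nij1] := eqVneq j i.+1.
  subst j.
  have Ji : pair_at i i by rewrite /pair_at eqxx.
  have Ji1 : pair_at i i.+1 by rewrite /pair_at eqxx orbT.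
  have [N hN HN] := raises_highest (pair_at i) (supported_move hM i0 hi).
  have [N' hN' HN'] := raises_highest (pair_at i) (supported_move hM j0 hj).
  have e : N = N'.
    apply: (three_columns hM i0 _ _ HN HN').
      exact: raises_trans (raises1 Ji i0 hi) hN.
    exact: raises_trans (raises1 Ji1 j0 hj) hN'.
  by exists N; [|rewrite e]; apply: raises_sub; [| exact: hN | | exact: hN'].
exists (move_val j c (move_val i b M)).
  by apply: raises1 => //; rewrite !move_val_out //; lia.
rewrite move_val_comm; last lia.
by apply: raises1 => //; rewrite !move_val_out //; lia.
Qed.

(** Newman's argument, by induction on the potential. *)
Lemma highest_unique m n M N N' : supported m n M ->
  raises everywhere M N -> raises everywhere M N' ->
  highest everywhere N -> highest everywhere N' -> N = N'.
Proof.
have [k] := ubnP (potential m n M); elim: k M N N' => // k IH M N N' hk hM.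
have top j b (P Q : matrix) : highest everywhere P -> 0 < j ->
    raising (P j) (P j.+1) b -> False.
  move=> hP j0 hb; have [pB pA] := raising_pred hb; case: hb => b0 h _.
  by have := h 0 b0; have := hP j b isT j0; rewrite !cnt0; lia.
move=> /raises_inv[->|[i [b [_ i0 hi hN]]]] /raises_inv[->|[j [c [_ j0 hj hN']]]] H H' //.
- by case: (top _ _ _ M H j0 hj).
- by case: (top _ _ _ M H' i0 hi).
have [Q hQ hQ'] := local_confluence hM i0 j0 hi hj.
have sM1 := supported_move hM i0 hi; have sM2 := supported_move hM j0 hj.
have pM1 := potential_move hM i0 hi; have pM2 := potential_move hM j0 hj.
have [R hR HR] := raises_highest everywhere (supported_raises sM1 hQ).
rewrite (IH _ N R _ sM1 hN (raises_trans hQ hR) H HR); last lia.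
by rewrite (IH _ N' R _ sM2 hN' (raises_trans hQ' hR) H' HR); last lia.
Qed.

(** * Reflections and extremal weights *)

Fixpoint raise_iter (j d : nat) (M N : matrix) : Prop :=
  if d is d'.+1 then
    exists2 b, raising (M j) (M j.+1) b & raise_iter j d' (move_val j b M) N
  else N = M.

Lemma raise_iter_raises (J : nat -> bool) j d M N : J j -> 0 < j ->
  raise_iter j d M N -> raises J M N.
Proof.
move=> hj j0; elim: d M => [|d IH] M /=; first by move=> ->; apply: raises0.
by case=> b hb /IH; apply: raisesS.
Qed.

(** A move lowers the maximal difference of the counts by exactly one, so [d]
    moves are possible as soon as some difference is at least [d]. *)
Lemma raise_iter_ex m n j d (M : matrix) t : supported m n M -> 0 < j ->
  cnt (M j) t + d <= cnt (M j.+1) t -> exists N, raise_iter j d M N.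
Proof.
elim: d M t => [|d IH] M t hM j0 ht; first by exists M.
have bd i v : M i v -> v <= n by move=> /hM; lia.
have [|b hb] := @raising_ex n _ _ t (bd j) (bd j.+1); first lia.
have [Bb Ab] := raising_mem hb; have [pB pA] := raising_pred hb.
have [N hN] : exists N, raise_iter j d (move_val j b M) N.
  apply: (IH _ b.-1 (supported_move hM j0 hb) j0).
  rewrite move_val_l move_val_r; case: hb => b0 _ h2.
  have := cnt_add b.-1 b0 Ab; have := cnt_rem b.-1 b0 Bb; have := h2 t; lia.
by exists N, b.
Qed.

Lemma move_val_inj (M M' : matrix) j b b' :
  raising (M j) (M j.+1) b -> raising (M' j) (M' j.+1) b' ->
  move_val j b M = move_val j b' M' -> M = M'.
Proof.
move=> h h' e; have eA := congr1 (fun P => P j) e; have eB := congr1 (fun P => P j.+1) e.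
rewrite !move_val_l !move_val_r in eA eB.
have eb := raising_inj h h' eA eB; subst b'.
have [Bb Ab] := raising_mem h; have [Bb' Ab'] := raising_mem h'.
apply/funext => k; have ek := congr1 (fun P => P k) e.
case: (eqVneq k j) => [->|kj].
  apply/funext=> v; have := congr1 (fun P => P v) eA; rewrite /add_val.
  by case: eqP => [->|_]; rewrite ?(negPf Ab) ?(negPf Ab') // !orbF.
case: (eqVneq k j.+1) => [->|kj1]; last by rewrite !move_val_out in ek.
apply/funext=> v; have := congr1 (fun P => P v) eB; rewrite /rem_val.
by case: eqP => [->|_]; rewrite ?Bb ?Bb' // !andbT.
Qed.

Lemma raise_iter_inj j d M M' N :
  raise_iter j d M N -> raise_iter j d M' N -> M = M'.
Proof.
elim: d M M' => [|d IH] M M' /=; first by move=> -> ->.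
by case=> b hb hN [b' hb' hN']; apply: (move_val_inj hb hb'); apply: IH hN hN'.
Qed.

Lemma raise_iter_weight m n j d M N k : supported m n M -> 0 < j ->
  raise_iter j d M N ->
  weight n N k + d * (k == j.+1) = weight n M k + d * (k == j).
Proof.
elim: d M => [|d IH] M hM j0 /=; first by move=> ->.
case=> b hb /(IH _ (supported_move hM j0 hb) j0).
by have := weight_move k hM j0 hb; rewrite !mulSn; lia.
Qed.

Definition adj_swap (j k : nat) : nat :=
  if k == j then j.+1 else if k == j.+1 then j else k.

(** The Weyl group reflection of the crystal, for increasing weights. *)
Lemma raise_iter_reflect m n j d M N k : supported m n M -> 0 < j ->
  weight n M j.+1 = weight n M j + d ->
  raise_iter j d M N -> weight n N k = weight n M (adj_swap j k).
Proof.
move=> hM j0 hd /(raise_iter_weight k hM j0); rewrite /adj_swap.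
case: (eqVneq k j) => [->|kj]; first by have -> : (j == j.+1) = false by [lia]; lia.
by case: (eqVneq k j.+1) => [->|kj1]; lia.
Qed.

Definition weights (m n : nat) (M : matrix) : seq nat :=
  [seq weight n M j | j <- iota 1 m].

Lemma perm_map_iota (f : nat -> nat) m : (forall k, 0 < k <= m -> 0 < f k <= m) ->
  {in iota 1 m &, injective f} -> perm_eq [seq f k | k <- iota 1 m] (iota 1 m).
Proof.
move=> hf inj; apply: uniq_perm; rewrite ?iota_uniq ?map_inj_in_uniq ?iota_uniq //.
have sub : {subset [seq f k | k <- iota 1 m] <= iota 1 m}.
  by move=> x /mapP[k]; rewrite !mem_iota => hk ->; have := hf k; lia.
apply: (uniq_min_size _ sub _).2; rewrite ?map_inj_in_uniq ?iota_uniq //.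
by rewrite size_map.
Qed.

Lemma perm_weights m n (M N : matrix) (f : nat -> nat) :
  (forall k, 0 < k <= m -> 0 < f k <= m) -> {in iota 1 m &, injective f} ->
  (forall k, 0 < k <= m -> weight n N k = weight n M (f k)) ->
  perm_eq (weights m n N) (weights m n M).
Proof.
move=> hf inj hw.
have -> : weights m n N = [seq weight n M j | j <- [seq f k | k <- iota 1 m]].
  rewrite -map_comp; apply/eq_in_map => k; rewrite mem_iota => hk /=.
  by apply: hw; lia.
exact/perm_map/perm_map_iota.
Qed.

Lemma perm_weights_reflect m n j d M N : supported m n M -> 0 < j -> j < m ->
  weight n M j.+1 = weight n M j + d ->
  raise_iter j d M N -> perm_eq (weights m n N) (weights m n M).
Proof.
move=> hM j0 jm hd hN; apply: (@perm_weights m n M N (adj_swap j)).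
- by move=> k hk; rewrite /adj_swap; case: eqP => [_|_]; [lia|case: eqP => _; lia].
- move=> k k' _ _; rewrite /adj_swap.
  case: (eqVneq k j) => ?; case: (eqVneq k' j) => ?; case: (eqVneq k j.+1) => ?;
    case: (eqVneq k' j.+1) => ?; lia.
- by move=> k _; exact: (raise_iter_reflect k hM j0 hd hN).
Qed.

Lemma sorted_map_iota (f : nat -> nat) a p :
  (forall j, a <= j -> j.+1 < a + p -> f j.+1 <= f j) ->
  sorted geq [seq f j | j <- iota a p].
Proof.
elim: p a => [|[|p] IH] a h //=; rewrite h //=; last lia.
by apply: (IH a.+1) => j h1 h2; apply: h; lia.
Qed.

Lemma supported_weight0 m n M j : supported m n M -> ~~ (0 < j <= m) -> weight n M j = 0.
Proof.
move=> hM hj; apply/eqP; rewrite /weight /cnt -leqn0 leqNgt -has_count.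
by apply/hasPn => v _; apply: contraNN hj => /hM /andP[].
Qed.

(** Reflect both matrices at an ascent of their common weight: they become
    equal by induction on the potential, hence were equal because moves are
    injective.  Without an ascent the weight is that of [T], so both have the
    potential of [T] and no move leads from them to [T]: both are [T]. *)
Lemma extremal_unique m n M1 M2 T : supported m n M1 -> supported m n M2 ->
  raises everywhere M1 T -> raises everywhere M2 T -> highest everywhere T ->
  (forall j, weight n M1 j = weight n M2 j) ->
  perm_eq (weights m n M1) (weights m n T) -> M1 = M2.
Proof.
have [k] := ubnP (potential m n M1); elim: k M1 M2 => // k IH M1 M2 hk s1 s2 r1 r2 hT hw hp.
have sT := supported_raises s1 r1.
have [[j [j0 hj]]|hn] := pselect (exists j, 0 < j /\ weight n M1 j < weight n M1 j.+1).
  have jm : j < m.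
    by rewrite ltnNge; apply/negP => h; move: hj; rewrite (supported_weight0 (j:=j.+1) s1) //; lia.
  pose d := weight n M1 j.+1 - weight n M1 j.
  have hd1 : weight n M1 j.+1 = weight n M1 j + d by lia.
  have hd2 : weight n M2 j.+1 = weight n M2 j + d by rewrite -!hw.
  have [N1 hN1] : exists N, raise_iter j d M1 N by apply: (raise_iter_ex (t:=n) s1 j0); rewrite -/(weight n M1 j) -hd1.
  have [N2 hN2] : exists N, raise_iter j d M2 N by apply: (raise_iter_ex (t:=n) s2 j0); rewrite -/(weight n M2 j) -hd2.
  have t1 : raises everywhere M1 N1 by apply: raise_iter_raises hN1.
  have t2 : raises everywhere M2 N2 by apply: raise_iter_raises hN2.
  have u1 := supported_raises s1 t1; have u2 := supported_raises s2 t2.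
  have conv M N : supported m n M -> raises everywhere M N -> raises everywhere M T -> raises everywhere N T.
    move=> sM h h'; have [R hR HR] := raises_highest everywhere (supported_raises sM h).
    by rewrite (highest_unique sM h' (raises_trans h hR) hT HR).
  apply: (@raise_iter_inj j d _ _ N1) => //; suff -> : N1 = N2 by [].
  apply: IH => //.
  - have [h1 h2] := potential_raises s1 t1.
    have : potential m n N1 != potential m n M1; last lia.
    apply/eqP => /h2 e; have := raise_iter_reflect j s1 j0 hd1 hN1.
    by rewrite e /adj_swap eqxx; lia.
  - exact: (conv M1).
  - exact: (conv M2).
  - by move=> i; rewrite (raise_iter_reflect i s1 j0 hd1 hN1) (raise_iter_reflect i s2 j0 hd2 hN2).
  - exact: perm_trans (perm_weights_reflect s1 j0 jm hd1 hN1) hp.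
have dec (M : matrix) : (forall j, 0 < j -> weight n M j.+1 <= weight n M j) -> sorted geq (weights m n M).
  by move=> h; apply: sorted_map_iota => j j0 _; apply: h.
have e : weights m n M1 = weights m n T.
  apply: (sorted_eq (leT := geq)) => //.
  - by move=> x y z /= h1 h2; apply: leq_trans h2 h1.
  - by move=> x y h; apply/eqP; rewrite eqn_leq andbC.
  - by apply: dec => j j0; rewrite leqNgt; apply/negP => h; apply: hn; exists j.
  - by apply: dec => j j0; apply: hT.
have ew j : weight n M1 j = weight n T j.
  have [hj|hj] := boolP (0 < j <= m); last first.
    by rewrite !(supported_weight0 (m:=m)).
  have h (M : matrix) : weight n M j = nth 0 (weights m n M) j.-1.
    rewrite (nth_map 0) ?size_iota; last lia.
    by rewrite nth_iota; [congr weight|]; lia.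
  by rewrite !h e.
have ep (M : matrix) : (forall j, weight n M j = weight n T j) -> potential m n M = potential m n T.
  by move=> h; apply: eq_bigr => i _; rewrite h.
rewrite -((potential_raises s1 r1).2 (esym (ep _ ew))).
by apply: (potential_raises s2 r2).2; symmetry; apply: ep => j; rewrite -hw.
Qed.

Lemma sort_prefix m n M : supported m n M -> 
  exists N, [/\ raises (fun j => j.+1 < m) M N,
    forall j, 0 < j -> j.+1 < m -> weight n N j.+1 <= weight n N j &
    perm_eq (weights m n N) (weights m n M)].
Proof.
have [k] := ubnP (potential m n M); elim: k M => // k IH M hk sM.
have [[j [j0 jm hj]]|hn] :=
    pselect (exists j, [/\ 0 < j, j.+1 < m & weight n M j < weight n M j.+1]); last first.
  exists M; split=> // [|j j0 jm]; first exact: raises0.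
  by rewrite leqNgt; apply/negP => h; apply: hn; exists j.
pose d := weight n M j.+1 - weight n M j.
have hd : weight n M j.+1 = weight n M j + d by lia.
have [N hN] : exists N, raise_iter j d M N.
  by apply: (raise_iter_ex (t:=n) sM j0); rewrite -/(weight n M j) -hd.
have t : raises (fun j => j.+1 < m) M N by apply: raise_iter_raises hN.
have [//||P [h1 h2 h3]] := IH N; last 2 first.
- exact: supported_raises sM t.
- exists P; split=> //; first exact: raises_trans t h1.
  by apply: perm_trans h3 (perm_weights_reflect sM j0 (ltnW jm) hd hN).
have [h1 h2] := potential_raises sM t.
have : potential m n N != potential m n M; last lia.
apply/eqP => /h2 e; have := raise_iter_reflect j sM j0 hd hN.
by rewrite e /adj_swap eqxx; lia.
Qed.

(** The order of the lengths of the other columns is irrelevant: sorting them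
    leaves the last column untouched and gives [S] the weight of [Z]. *)
Lemma last_column_unique m n S Z T : supported m n S -> supported m n Z ->
  0 < m -> raises everywhere S T -> raises everywhere Z T -> highest everywhere T ->
  perm_eq (weights m n S) (weights m n T) -> perm_eq (weights m n Z) (weights m n T) ->
  (forall j, 0 < j -> j.+1 < m -> weight n Z j.+1 <= weight n Z j) ->
  weight n S m = weight n Z m -> S m = Z m.
Proof.
move=> sS sZ m0 rS rZ hT pS pZ decZ ewm.
have [N [rN decN pN]] := sort_prefix sS.
have sN := supported_raises sS rN.
have eNm : N m = S m by apply: (raises_out rN) => /=; lia.
have rN' : raises everywhere S N by apply: raises_sub rN.
have [R hR HR] := raises_highest everywhere sN.
have eR : T = R := highest_unique sS rS (raises_trans rN' hR) hT HR.
rewrite -eR in hR.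
rewrite -eNm; congr (_ m); apply: (extremal_unique sN sZ hR rZ hT); last first.
  exact: perm_trans pN pS.
case: m m0 {rN} sS sZ pS pZ decZ ewm decN pN sN eNm => // m _ sS sZ pS pZ decZ ewm decN pN sN eNm.
have wl (M : matrix) : weights m.+1 n M = rcons [seq weight n M j | j <- iota 1 m] (weight n M m.+1).
  by rewrite /weights iota_rcons map_rcons add1n.
have ewm' : weight n N m.+1 = weight n Z m.+1 by rewrite -ewm /weight eNm.
have pp : perm_eq [seq weight n N j | j <- iota 1 m] [seq weight n Z j | j <- iota 1 m].
  have : perm_eq (weights m.+1 n N) (weights m.+1 n Z).
    by apply: perm_trans pN (perm_trans pS _); rewrite perm_sym.
  by rewrite !wl ewm' perm_rcons perm_sym perm_rcons perm_cons perm_sym.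
have dec (M : matrix) : (forall j, 0 < j -> j.+1 < m.+1 -> weight n M j.+1 <= weight n M j) ->
    sorted geq [seq weight n M j | j <- iota 1 m].
  by move=> h; apply: sorted_map_iota => j j0 jm; apply: h; lia.
have e : [seq weight n N j | j <- iota 1 m] = [seq weight n Z j | j <- iota 1 m].
  apply: (sorted_eq (leT := geq)) => //; try exact: dec.
  - by move=> x y z /= h1 h2; apply: leq_trans h2 h1.
  - by move=> x y h; apply/eqP; rewrite eqn_leq andbC.
move=> j; have [hj|hj] := boolP (0 < j <= m.+1); last first.
  by rewrite !(supported_weight0 (m:=m.+1)).
have [->//|jm] := eqVneq j m.+1.
have h (M : matrix) : weight n M j = nth 0 [seq weight n M j | j <- iota 1 m] j.-1.
  rewrite (nth_map 0) ?size_iota; last lia.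
  by rewrite nth_iota; [congr weight|]; lia.
by rewrite !h e.
Qed.

(** * Shapes *)

Lemma col_len_mono lam j j' : j <= j' -> col_len lam j' <= col_len lam j.
Proof. by move=> h; apply: sub_count => x /=; apply: leq_trans. Qed.

Lemma in_shapeE lam j i : is_partition lam ->
  in_shape lam j i = [&& 0 < i, 0 < j & i <= col_len lam j].
Proof.
move=> hlam; rewrite /in_shape /row_len; case: i => // i; case: j => //= j.
elim: lam i hlam => [|x s IH] i /=; first by rewrite nth_nil.
move=> hp; have hs := path_sorted hp.
have h0 : x <= j -> col_len s j.+1 = 0.
  move=> hx; apply/eqP; rewrite /col_len -leqn0 leqNgt -has_count.
  have ge_trans : transitive geq by move=> u v w /= h1 h2; apply: leq_trans h2 h1.
  apply/hasPn => y hy; have /allP/(_ y hy) /= := order_path_min ge_trans hp.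
  by rewrite -ltnNge ltnS => h; apply: leq_trans hx.
case: i => [|i] /=; last rewrite IH //; rewrite /col_len /= -/(col_len s _);
  by case: (leqP j.+1 x) => [h|/h0 ->] /=; lia.
Qed.

(** A predicate that is closed under predecessors holds on an initial segment
    of [1, m], whose length is the count. *)
Lemma cnt_initial (p : nat -> bool) m c : (forall k, 0 < k -> p k.+1 -> p k) ->
  0 < c -> (c <= cnt p m) = (c <= m) && p c.
Proof.
move=> hp c0; elim: m => [|m IH]; first by rewrite cnt0; case: c c0.
rewrite cntS; case E: (p m.+1); last first.
  by rewrite addn0 IH; case: (ltngtP c m.+1) => [h|h|->]; rewrite ?E ?andbF //; lia.
have down k : k <= m -> p (m - k).+1.
  elim: k => [|k IHk] hk; first by rewrite subn0.
  have e : (m - k).+1 = (m - k.+1).+2 by lia.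
  by apply: hp => //; rewrite -e; apply: IHk; lia.
have full : cnt p m = m.
  have : forall q, q <= m -> cnt p q = q.
    elim=> // q IHq hq; rewrite cntS IHq ?(ltnW hq) //.
    by have := down (m - q.+1).+1; have -> : (m - (m - q.+1).+1) = q by [lia]; move=> ->; lia.
  by apply.
rewrite full addn1; case: leqP => //= h.
by have := down (m - c.-1); have -> : (m - (m - c.-1)).+1 = c by [lia]; move=> ->; lia.
Qed.

(** The partition with column lengths [a 1], ..., [a m]. *)
Definition rows_of (m : nat) (a : nat -> nat) : seq nat :=
  [seq cnt (fun c => i <= a c) m | i <- iota 1 (a 1)].

Lemma noninc_le (a : nat -> nat) c c' : (forall k, 0 < k -> a k.+1 <= a k) ->
  0 < c -> c <= c' -> a c' <= a c.
Proof.
move=> h c0 /subnKC <-; elim: (c' - c) => [|k IH]; first by rewrite addn0.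
by rewrite addnS; apply: leq_trans (h _ _) IH; lia.
Qed.

Lemma rows_of_partition m a : is_partition (rows_of m a).
Proof. by apply: sorted_map_iota => i _ _; apply: sub_count => c; apply: ltnW. Qed.

Lemma in_rows_of m a j i : (forall c, 0 < c -> a c.+1 <= a c) ->
  (forall c, m < c -> a c = 0) ->
  in_shape (rows_of m a) j i = [&& 0 < i, 0 < j & i <= a j].
Proof.
move=> h hm; rewrite /in_shape /row_len; case: i => // i; case: j => //= j.
case: (ltnP i (a 1)) => hi; last first.
  rewrite nth_default ?size_map ?size_iota //; symmetry; rewrite ltn0 ltnNge.
  by rewrite (leq_trans _ hi) //; apply: (noninc_le h).
rewrite (nth_map 0) ?size_iota // nth_iota // add1n cnt_initial //; last first.
  by move=> k k0 hk; apply: leq_trans hk (h k k0).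
by case: (leqP j.+1 m) => //= hj; rewrite hm.
Qed.

(** * Fillings and their columns *)

Definition value_set (f : nat -> option nat) : nat -> bool :=
  fun v => `[< exists i, f i = Some v >].

Lemma value_setP f v : reflect (exists i, f i = Some v) (value_set f v).
Proof. exact: asboolP. Qed.

Definition value_le (t : nat) (o : option nat) : bool :=
  if o is Some w then w <= t else false.

Lemma cnt_value_set N f t : (forall i w, f i = Some w -> (i < N) && (0 < w)) ->
  (forall i i' w, f i = Some w -> f i' = Some w -> i = i') ->
  cnt (value_set f) t = \sum_(i < N) value_le t (f i).
Proof.
move=> hN inj; elim: t => [|t IH].
  rewrite cnt0 big1 // => i _; case E: (f i) => [w|] //=.
  by have := hN _ _ E; lia.
have -> : \sum_(i < N) value_le t.+1 (f i) =
    \sum_(i < N) value_le t (f i) + \sum_(i < N) (f i == Some t.+1).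
  rewrite -big_split; apply: eq_bigr => i _ /=; case: (f i) => //= w.
  rewrite -[Some w == _]/(w == t.+1); lia.
rewrite cntS IH; congr addn.
case: value_setP => [[i hi]|hn]; last first.
  by rewrite big1 // => i _; case: eqP => // e; case: hn; exists i.
have iN : i < N by case/andP: (hN _ _ hi).
rewrite (bigD1 (Ordinal iN)) //= hi eqxx big1 // => i'.
by rewrite -val_eqE /= => ne; case: eqP => // e; move: ne; rewrite (inj _ _ _ e hi) eqxx.
Qed.

Definition cols (P : filling) : matrix := fun j => value_set (P j).

(** All pairs of boxes are compared, not only neighbours: in this form the
    property still makes sense, and is preserved, while a hole travels through
    the filling. *)
Definition semistd (P : filling) : Prop := forall j i j' i' u w,
  j <= j' -> i <= i' -> P j i = Some u -> P j' i' = Some w ->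
  u <= w /\ (i < i' -> u < w).

Definition entries_in (n : nat) (P : filling) : Prop :=
  forall j i v, P j i = Some v -> 0 < v <= n.

Lemma semistd_inj P j i i' w : semistd P ->
  P j i = Some w -> P j i' = Some w -> i = i'.
Proof.
move=> h e e'; case: (ltngtP i i') => // hi.
  by have [_ /(_ hi)] := h _ _ _ _ _ _ (leqnn j) (ltnW hi) e e'; rewrite ltnn.
by have [_ /(_ hi)] := h _ _ _ _ _ _ (leqnn j) (ltnW hi) e' e; rewrite ltnn.
Qed.

(** Column heights of two nested partitions with at most [m] columns. *)
Definition nested (m : nat) (a b : nat -> nat) : Prop :=
  [/\ forall c, 0 < c -> a c.+1 <= a c, forall c, 0 < c -> b c.+1 <= b c,
      forall c, 0 < c -> a c <= b c & forall c, m < c -> b c = 0].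

Definition fills (a b : nat -> nat) (P : filling) : Prop :=
  forall c r, isSome (P c r) = (0 < c) && (a c < r <= b c).

(** A state of a slide: the skew shape between [a] and [b] still contains the
    box (j, i) of the hole. *)
Definition holed (a b : nat -> nat) (j i : nat) (P : filling) : Prop :=
  [/\ 0 < j, a j < i <= b j &
    forall c r, isSome (P c r) = [&& 0 < c, a c < r <= b c & (c, r) != (j, i)]].

Lemma isSome_ex (T : Type) (o : option T) : isSome o -> exists x, o = Some x.
Proof. by case: o => // x _; exists x. Qed.

Section HoledStep.

Variables (n m : nat) (a b : nat -> nat) (j i : nat) (P : filling).
Hypotheses (hab : nested m a b) (hP : holed a b j i P).
Hypotheses (ssP : semistd P) (enP : entries_in n P).

Let P_ji : P j i = None.
Proof. by case: hP => _ _ /(_ j i); rewrite eqxx !andbF; case: (P j i). Qed.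

Let P_mem c r : 0 < c -> a c < r <= b c -> (c, r) != (j, i) -> exists v, P c r = Some v.
Proof. by move=> h1 h2 h3; apply: isSome_ex; case: hP => _ _ ->; rewrite h1 h2. Qed.

Let P_supp c r v : P c r = Some v -> [/\ 0 < c, a c < r <= b c & (c, r) != (j, i)].
Proof. by move=> e; case: hP => _ _ /(_ c r); rewrite e => /esym/and3P. Qed.

Lemma cols_up y : P j i.+1 = Some y -> cols (move_entry P (j, i.+1) (j, i)) = cols P.
Proof.
move=> hy; apply/funext=> c; apply/funext=> v; rewrite /cols.
have [->|cj] := eqVneq c j; last first.
  congr (value_set _ v); apply/funext=> r.
  by rewrite /move_entry !xpair_eqE (negPf cj).
apply/value_setP/value_setP=> [[r]|[r hr]].
  rewrite /move_entry !xpair_eqE !eqxx /=.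
  case: eqP => [_ hv|_]; first by exists i.+1.
  by case: eqP => // _ hv; exists r.
case: (eqVneq r i.+1) => [er|er].
  by exists i; rewrite /move_entry eqxx /= -er.
exists r; rewrite /move_entry !xpair_eqE !eqxx (negPf er) /=.
by case: eqP => [e|//]; rewrite e P_ji in hr.
Qed.

Lemma cols_left x : P j.+1 i = Some x ->
  cols (move_entry P (j.+1, i) (j, i)) = move_val j x (cols P).
Proof.
move=> hx; apply/funext=> c; apply/funext=> v.
have [->|cj] := eqVneq c j.
  rewrite move_val_l /cols /add_val.
  apply/value_setP/orP=> [[r]|[/value_setP[r hr]|/eqP ->]].
  - rewrite /move_entry !xpair_eqE !eqxx /=.
    case: eqP => [_|_]; first by rewrite hx => -[->]; right.
    rewrite eqn_leq ltnn andbF /= => hr; left; apply/value_setP; by exists r.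
  - exists r; rewrite /move_entry !xpair_eqE eqxx /=.
    case: eqP => [e|_]; first by rewrite e P_ji in hr.
    by rewrite eqn_leq ltnn andbF.
  - by exists i; rewrite /move_entry eqxx.
have [->|cj1] := eqVneq c j.+1; last first.
  rewrite move_val_out // /cols; congr (value_set _ v); apply/funext=> r.
  by rewrite /move_entry !xpair_eqE (negPf cj) (negPf cj1).
have jj : (j.+1 == j) = false by lia.
rewrite move_val_r /cols /rem_val.
apply/value_setP/andP=> [[r]|[/value_setP[r hr] hv]].
  rewrite /move_entry !xpair_eqE eqxx jj /=; case: eqP => // ri hr; split.
    by apply/value_setP; exists r.
  apply: contra_not_neq ri => ev; rewrite ev in hr.
  exact: (semistd_inj ssP hr hx).
exists r; rewrite /move_entry !xpair_eqE eqxx jj /=; case: eqP => // ri.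
by move: hv; rewrite ri hx in hr; case: hr => ->; rewrite eqxx.
Qed.

(** Comparing the two columns row by row: up to any value [t], column [j.+1]
    has at most [a j - a j.+1] entries more than column [j], plus one more if
    it counts the entry beside the hole; for [t = x] this is an equality. *)
Lemma raising_left x : P j.+1 i = Some x ->
  (forall y, P j i.+1 = Some y -> x < y) -> raising (cols P j) (cols P j.+1) x.
Proof.
move=> hx hxy; case: hab => na nb _ _; case: (hP) => j0 hi _.
have [_ hi1 _] := P_supp hx.
have aj := na j j0; have bj := nb j j0.
pose N := (b j).+1; pose D := \sum_(r < N) (a j.+1 < r <= a j).
have cA t : cnt (cols P j) t = \sum_(r < N) value_le t (P j r).
  apply: cnt_value_set => [r w hr|r r' w]; last exact: semistd_inj.
  by have [_ h _] := P_supp hr; have := enP hr; rewrite /N; lia.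
have cB t : cnt (cols P j.+1) t = \sum_(r < N) value_le t (P j.+1 r).
  apply: cnt_value_set => [r w hr|r r' w]; last exact: semistd_inj.
  by have [_ h _] := P_supp hr; have := enP hr; rewrite /N; lia.
have iN : i < N by rewrite /N; lia.
have cD t : D + (x <= t) + cnt (cols P j) t =
    \sum_(r < N) ((a j.+1 < r <= a j) + (x <= t) * (r == i :> nat) + value_le t (P j r)).
  by rewrite !big_split /= cA (@sum_delta N i (fun _ => x <= t)).
have le t : cnt (cols P j.+1) t <= D + (x <= t) + cnt (cols P j) t.
  rewrite cD cB; apply: leq_sum => -[r /= _] _.
  case E: (P j.+1 r) => [w|] //=; case: (leqP w t) => //= hw.
  have [_ hr _] := P_supp E.
  have [ra|ra] := leqP r (a j); first by have -> : a j.+1 < r by lia.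
  have [e|ri] := eqVneq r i.
    by rewrite e hx in E; case: E => ->; rewrite hw; lia.
  have [u hu] : exists u, P j r = Some u by apply: P_mem; rewrite ?xpair_eqE; lia.
  have [huw _] := ssP (leqnSn j) (leqnn r) hu E.
  by rewrite hu /= (leq_trans huw hw); lia.
have eq : cnt (cols P j.+1) x = D + 1 + cnt (cols P j) x.
  apply/eqP; rewrite eqn_leq; apply/andP; split; first by have := le x; rewrite leqnn.
  have := cD x; rewrite leqnn => ->; rewrite cB; apply: leq_sum => -[r /= _] _.
  have below : a j.+1 < r < i -> value_le x (P j.+1 r) = true.
    move=> hr; have [w hw] : exists w, P j.+1 r = Some w by apply: P_mem; rewrite ?xpair_eqE; lia.
    have [|h _] := ssP (leqnn j.+1) _ hw hx; first lia.
    by rewrite hw.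
  have [e|ri] := eqVneq r i; first by rewrite e P_ji hx /= leqnn; lia.
  case E: (P j r) => [u|] /=; last by case: (boolP (a j.+1 < r <= a j)) => // h; rewrite below //; lia.
  have [_ hr _] := P_supp E.
  have -> : (a j.+1 < r <= a j) = false by lia.
  case: (leqP u x) => //= ux.
  rewrite below //; have [//|ir] : r < i \/ i < r by lia.
    by lia.
  have [y hy] : exists y, P j i.+1 = Some y by apply: P_mem; rewrite ?xpair_eqE; lia.
  have [hyu _] := ssP (leqnn j) ir hy E.
  by have := hxy _ hy; lia.
split=> [|t ht|t]; first by have := enP hx; lia.
- by have := le t; rewrite eq; have -> : (x <= t) = false by [lia]; lia.
- by have := le t; rewrite eq; case: (x <= t); lia.
Qed.

End HoledStep.

Lemma move_entryE P q p c r : move_entry P q p c r =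
  if (c, r) == p then P q.1 q.2 else if (c, r) == q then None else P c r.
Proof. by []. Qed.

Lemma holed_up a b j i P : holed a b j i P -> isSome (P j i.+1) ->
  holed a b j i.+1 (move_entry P (j, i.+1) (j, i)).
Proof.
case=> j0 hi hP; rewrite hP => /and3P[_ hi1 _]; split=> // c r.
rewrite move_entryE; case: eqP => [[-> ->]|/eqP h] /=.
  by rewrite hP !xpair_eqE j0; lia.
by case: eqP => [[-> ->]|/eqP h']; rewrite ?andbF ?hP ?h.
Qed.

Lemma holed_left a b j i P : holed a b j i P -> isSome (P j.+1 i) ->
  holed a b j.+1 i (move_entry P (j.+1, i) (j, i)).
Proof.
case=> j0 hi hP; rewrite hP => /and3P[_ hi1 _]; split=> // c r.
rewrite move_entryE; case: eqP => [[-> ->]|/eqP h] /=.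
  by rewrite hP !xpair_eqE j0; lia.
by case: eqP => [[-> ->]|/eqP h']; rewrite ?andbF ?hP ?h.
Qed.

Lemma entries_in_move n P p q : entries_in n P -> entries_in n (move_entry P q p).
Proof.
move=> h c r v; rewrite move_entryE; case: eqP => _; first exact: h.
by case: eqP => // _; apply: h.
Qed.

(** Neighbours of the moved entry inherit their inequalities from its old
    place, except for those to the right: there the entry [x] beside the hole,
    which is not smaller than [y], mediates. *)
Lemma semistd_up m a b j i P y : nested m a b -> holed a b j i P ->
  semistd P -> P j i.+1 = Some y ->
  (forall x, P j.+1 i = Some x -> y <= x) ->
  semistd (move_entry P (j, i.+1) (j, i)).
Proof.
move=> [na nb nab _] [j0 hi hP] ss hy hyx c r c' r' u w hc hr.
have supp d s v : P d s = Some v -> [&& 0 < d, a d < s <= b d & (d, s) != (j, i)].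
  by move=> e; rewrite -hP e.
have mem d s : 0 < d -> a d < s <= b d -> (d, s) != (j, i) -> exists v, P d s = Some v.
  by move=> h1 h2 h3; apply: isSome_ex; rewrite hP h1 h2.
have [_ hi1 _] := and3P (supp _ _ _ hy).
rewrite !move_entryE /=; case: eqP => [[ec er]|/eqP n1].
  rewrite hy ec er in hc hr * => -[<-].
  case: eqP => [[ec' er']|/eqP n2]; first by case=> <-; split=> //; lia.
  case: eqP => // /eqP n3 hw.
  have [hr1|hr1] := leqP i.+1 r'.
    have [h1 h2] := ss _ _ _ _ _ _ hc hr1 hy hw; split=> // _.
    have [h|e] : i.+1 < r' \/ r' = i.+1 by lia.
      exact: h2.
    rewrite e in hw n3 *; have jc : j < c' by move: n3; rewrite xpair_eqE eqxx andbT; lia.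
    have [_ hb' _] := and3P (supp _ _ _ hw).
    have ac' : a c' <= a j by apply: (noninc_le na); lia.
    have bj1 : b c' <= b j.+1 by apply: (noninc_le nb); lia.
    have aj1 := na j j0.
    have [x hx] : exists x, P j.+1 i = Some x by apply: mem; rewrite ?xpair_eqE; lia.
    have [z hz] : exists z, P c' i = Some z by apply: mem; rewrite ?xpair_eqE; lia.
    have [hxz _] := ss _ _ _ _ _ _ jc (leqnn i) hx hz.
    have [_ hzw] := ss _ _ _ _ _ _ (leqnn c') (leqnSn i) hz hw.
    by have := hyx _ hx; have := hzw (ltnSn i); lia.
  have e : r' = i by lia.
  rewrite e in hw n2 *; have jc : j < c' by move: n2; rewrite xpair_eqE eqxx andbT; lia.
  have [_ hb' _] := and3P (supp _ _ _ hw).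
  have bj1 : b c' <= b j.+1 by apply: (noninc_le nb); lia.
  have aj1 := na j j0.
  have [x hx] : exists x, P j.+1 i = Some x by apply: mem; rewrite ?xpair_eqE; lia.
  have [hxw _] := ss _ _ _ _ _ _ jc (leqnn i) hx hw.
  by split; [apply: leq_trans (hyx _ hx) hxw|lia].
case: eqP => // /eqP n2 hu.
case: eqP => [[ec' er']|/eqP n3].
  rewrite hy ec' er' in hc hr * => -[<-].
  have [h1 h2] := ss _ _ _ _ _ _ hc (leqW hr) hu hy.
  by split=> // h; apply: h2; lia.
by case: eqP => // _; apply: ss hu.
Qed.

Lemma semistd_left m a b j i P x : nested m a b -> holed a b j i P ->
  semistd P -> P j.+1 i = Some x ->
  (forall y, P j i.+1 = Some y -> x < y) ->
  semistd (move_entry P (j.+1, i) (j, i)).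
Proof.
move=> [na nb nab _] [j0 hi hP] ss hx hxy c r c' r' u w hc hr.
have supp d s v : P d s = Some v -> [&& 0 < d, a d < s <= b d & (d, s) != (j, i)].
  by move=> e; rewrite -hP e.
have mem d s : 0 < d -> a d < s <= b d -> (d, s) != (j, i) -> exists v, P d s = Some v.
  by move=> h1 h2 h3; apply: isSome_ex; rewrite hP h1 h2.
have [_ hi1 _] := and3P (supp _ _ _ hx).
rewrite !move_entryE /=; case: eqP => [[ec er]|/eqP n1].
  rewrite hx ec er in hc hr * => -[<-].
  case: eqP => [[ec' er']|/eqP n2]; first by case=> <-; split=> //; lia.
  case: eqP => // /eqP n3 hw.
  have [jc|jc] := ltnP j c'; first by apply: ss hx hw.
  have e : c' = j by lia.
  rewrite e in hw n2 *; have ir : i < r' by move: n2; rewrite xpair_eqE eqxx /=; lia.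
  have [_ hb' _] := and3P (supp _ _ _ hw).
  have [y hy] : exists y, P j i.+1 = Some y by apply: mem; rewrite ?xpair_eqE; lia.
  have [hyw _] := ss _ _ _ _ _ _ (leqnn j) ir hy hw.
  by have := hxy _ hy; split; lia.
case: eqP => // /eqP n2 hu.
case: eqP => [[ec' er']|/eqP n3].
  rewrite hx ec' er' in hc hr * => -[<-].
  by have := ss _ _ _ _ _ _ (leqW hc) hr hu hx.
by case: eqP => // _; apply: ss hu.
Qed.

(** * Slides as sequences of raising moves *)

(** Up moves keep the column sets, left moves raise. *)
Lemma slide_raises n m a b P j i Q : slide P j i Q -> nested m a b ->
  holed a b j i P -> semistd P -> entries_in n P ->
  exists b', [/\ nested m a b', fills a b' Q, semistd Q, entries_in n Q &
    raises everywhere (cols P) (cols Q)].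
Proof.
move=> hs nab; elim: hs => {P j i Q} [P j i hl hd|P j i y Q hy hyx _ IH|P j i x Q hx hxy _ IH] hP ss en.
- case: (hP) => j0 hi hsupp; case: (nab) => na nb nle nz.
  have bj : b j = i.
    move: (hsupp j i.+1); rewrite hd xpair_eqE /= j0; lia.
  have bj1 : b j.+1 < i.
    have := na j j0; move: (hsupp j.+1 i); rewrite hl xpair_eqE /=; lia.
  exists (fun c => if c == j then i.-1 else b c); split=> //; last exact: raises0.
    split=> // c hc /=.
    - case: (eqVneq c.+1 j) => h; case: (eqVneq c j) => h'; try lia.
      + by have := nb c hc; rewrite h; lia.
      + by rewrite h'; lia.
      + exact: nb.
    - by case: eqP => [->|_]; [lia|exact: nle].
    - by have := nz c hc; case: eqP => [->|//]; lia.
  move=> c r; rewrite hsupp xpair_eqE; case: eqP => [->|_] /=; last by rewrite andbT.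
  lia.
- have sy : isSome (P j i.+1) by rewrite hy.
  have [|||b' [h1 h2 h3 h4 h5]] := IH.
  + exact: holed_up.
  + exact: (semistd_up nab hP ss hy hyx).
  + exact: entries_in_move.
  by exists b'; split=> //; rewrite -(cols_up hP hy).
- have sx : isSome (P j.+1 i) by rewrite hx.
  have [|||b' [h1 h2 h3 h4 h5]] := IH.
  + exact: holed_left.
  + exact: (semistd_left nab hP ss hx hxy).
  + exact: entries_in_move.
  exists b'; split=> //; rewrite (cols_left hP ss hx) in h5.
  have j0 : 0 < j by case: hP.
  exact: (raisesS (J := everywhere) isT j0 (raising_left nab hP ss en hx hxy) h5).
Qed.

Lemma slide_ex m a b P j i : nested m a b -> holed a b j i P ->
  exists Q, slide P j i Q.
Proof.
move=> nab; have [k] := ubnP (b 1 + m - (i + j)); elim: k P j i => // k IH P j i hk hP.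
case: (nab) => na nb _ nz; case: (hP) => j0 hi hsupp.
have bnd c r : isSome (P c r) -> c <= m /\ r <= b 1.
  rewrite hsupp => /and3P[c0 hr _]; split.
    by rewrite leqNgt; apply/negP => /nz; lia.
  by have : b c <= b 1 by [apply: (noninc_le nb)]; lia.
have up y : P j i.+1 = Some y -> (forall x, P j.+1 i = Some x -> y <= x) ->
    exists Q, slide P j i Q.
  move=> hy h; have sy : isSome (P j i.+1) by rewrite hy.
  have [|Q hQ] := IH _ _ _ _ (holed_up hP sy); last by exists Q; exact: SlideUp hy h hQ.
  by have := bnd _ _ sy; lia.
have left x : P j.+1 i = Some x -> (forall y, P j i.+1 = Some y -> x < y) ->
    exists Q, slide P j i Q.
  move=> hx h; have sx : isSome (P j.+1 i) by rewrite hx.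
  have [|Q hQ] := IH _ _ _ _ (holed_left hP sx); last by exists Q; exact: SlideLeft hx h hQ.
  by have := bnd _ _ sx; lia.
case ex: (P j.+1 i) => [x|]; case ey: (P j i.+1) => [y|].
- case: (leqP y x) => h.
    by apply: (up _ ey) => x'; rewrite ex => -[<-].
  by apply: (left _ ex) => y'; rewrite ey => -[<-].
- by apply: (left _ ex) => y'; rewrite ey.
- by apply: (up _ ey) => x'; rewrite ex.
- by exists P; apply: SlideStop.
Qed.

Lemma nested_of_skew mu nu : is_skew_shape mu nu ->
  nested (ncols nu) (col_len mu) (col_len nu).
Proof.
case=> pmu pnu sub; split=> [c _|c _|c c0|c hc]; try exact: col_len_mono.
  case: (posnP (col_len mu c)) => [->//|h].
  have := sub c (col_len mu c); rewrite !in_shapeE // c0 h leqnn /=; by apply.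
apply/eqP; rewrite -leqn0 leqNgt; apply/negP => h.
have : in_shape nu c 1 by rewrite in_shapeE //; lia.
by rewrite /in_shape /row_len /= nth0 -/(ncols nu); lia.
Qed.

Lemma fills_of_skew mu nu (P : filling) : is_skew_shape mu nu ->
  (forall j i, isSome (P j i) = in_skew mu nu j i) ->
  fills (col_len mu) (col_len nu) P.
Proof.
by case=> pmu pnu _ h c r; rewrite h /in_skew !in_shapeE //; lia.
Qed.

(** A slide starts by giving the inner corner to the skew shape, as its hole. *)
Lemma holed_of_corner m a b P j i : nested m a b -> fills a b P ->
  0 < j -> 0 < i -> a j = i -> a j.+1 < i ->
  let a' c := if c == j then i.-1 else a c in
  nested m a' b /\ holed a' b j i P.
Proof.
move=> [na nb nab nz] hP j0 i0 aj aj1 a'; have abj := nab j j0; split.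
  split=> // c c0; rewrite /a'.
    case: (eqVneq c.+1 j) => h; case: (eqVneq c j) => h'; try lia.
    - by have := na c c0; rewrite h; lia.
    - by rewrite h'; lia.
    - exact: na.
  by case: eqP => [->|_]; [lia|exact: nab].
split=> // [|c r]; first by rewrite /a' eqxx; lia.
by rewrite hP /a' xpair_eqE; case: eqP => [->|_] /=; lia.
Qed.

Lemma jdt_slide_raises n P Q : jdt_slide P Q -> semistd P -> entries_in n P ->
  [/\ semistd Q, entries_in n Q & raises everywhere (cols P) (cols Q)].
Proof.
case=> mu [nu [j [i [hsk hsupp hc hs]]]] ss en.
have nab := nested_of_skew hsk; have hf := fills_of_skew hsk hsupp.
move: hc; case: (hsk) => pmu pnu _; rewrite /inner_corner !in_shapeE // => /and3P[h1 h2 h3].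
have [nab' hh] := holed_of_corner (j:=j) (i:=i) nab hf ltac:(lia) ltac:(lia) ltac:(lia) ltac:(lia).
by have [b' []] := slide_raises hs nab' hh ss en.
Qed.

Lemma rectifies_raises n P Q : rectifies P Q -> semistd P -> entries_in n P ->
  [/\ semistd Q, entries_in n Q & raises everywhere (cols P) (cols Q)].
Proof.
elim=> {P Q} [P Q|P|P Q R _ IH1 _ IH2] ss en.
- exact: jdt_slide_raises.
- by split=> //; apply: raises0.
- have [h1 h2 h3] := IH1 ss en; have [h4 h5 h6] := IH2 h1 h2.
  by split=> //; apply: raises_trans h6.
Qed.

Lemma jdt_slide_of_nested m a b P j i Q : nested m a b -> fills a b P ->
  0 < j -> 0 < i -> a j = i -> a j.+1 < i -> slide P j i Q -> jdt_slide P Q.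
Proof.
move=> [na nb nab nz] hP j0 i0 aj aj1 hs.
have az c : m < c -> a c = 0.
  by move=> h; have := nz c h; have := nab c ltac:(lia); lia.
exists (rows_of m a), (rows_of m b), j, i; split=> //.
- split; try exact: rows_of_partition.
  by move=> c r; rewrite !in_rows_of // => /and3P[r0 c0 h]; have := nab c c0; lia.
- by move=> c r; rewrite hP /in_skew !in_rows_of //; lia.
- by rewrite /inner_corner !in_rows_of //; lia.
Qed.

(** Every slide removes one box from the inner shape. *)
Lemma rectification_ex n m a b P : nested m a b -> fills a b P ->
  semistd P -> entries_in n P ->
  exists b' Q, [/\ rectifies P Q, nested m (fun _ => 0) b', fills (fun _ => 0) b' Q,
    semistd Q & entries_in n Q].
Proof.
have [k] := ubnP (\sum_(c < m.+1) a c); elim: k a b P => // k IH a b P hk nab hP ss en.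
case: (nab) => na nb nle nz.
have az c : m < c -> a c = 0.
  by move=> h; have := nz c h; have := nle c ltac:(lia); lia.
have [h0|h0] := posnP (a 1).
  have a0 c : 0 < c -> a c = 0.
    by move=> c0; have : a c <= a 1 by [apply: (noninc_le na)]; lia.
  exists b, P; split=> //; first exact: rt_refl.
  by move=> c r; move: (hP c r) => ->; case: (posnP c) => //= c0; rewrite a0.
have [j [j0 aj aj1]] : exists j, [/\ 0 < j, 0 < a j & a j.+1 = 0].
  have [j] : exists j, [&& 0 < j, 0 < a j & a j.+1 == 0].
    apply: contrapT => hn; have : forall j, 0 < a j.+1.
      elim=> // j IHj; rewrite lt0n; apply/negP => e; apply: hn; exists j.+1.
      by rewrite IHj.
    by move/(_ m); rewrite az.
  by case/and3P=> ? ? /eqP ?; exists j.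
have [nab' hh] := holed_of_corner (j:=j) (i:=a j) nab hP j0 aj erefl ltac:(lia).
have [Q hQ] := slide_ex nab' hh.
have [b' [h1 h2 h3 h4 _]] := slide_raises hQ nab' hh ss en.
have [|b'' [R [r1 r2 r3 r4 r5]]] := IH _ _ _ _ h1 h2 h3 h4.
  have jm : j < m.+1 by rewrite ltnS leqNgt; apply/negP => /az; lia.
  rewrite -ltnS; apply: leq_trans hk; rewrite ltnS (bigD1 (Ordinal jm)) // [X in _ <= X](bigD1 (Ordinal jm)) //=.
  rewrite eqxx (eq_bigr (fun c : 'I_m.+1 => a c)); first by have := aj; lia.
  by move=> c; rewrite -val_eqE /= => /negPf ->.
exists b'', R; split=> //; apply: rt_trans r1; apply: rt_step.
by apply: (jdt_slide_of_nested nab hP j0 aj erefl _ hQ); lia.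
Qed.

(** * Scanning paths *)

Definition bot (T : nat -> nat -> nat) (h : nat -> nat) (c : nat) : nat :=
  if 0 < h c then T c (h c) else 0.

(** The EWIS runs through the weak left-to-right maxima, so this is also the
    value that a scanning path carries when it reaches column [c]. *)
Definition bots_max (T : nat -> nat -> nat) (h : nat -> nat) (c : nat) : nat :=
  \max_(1 <= i < c) bot T h i.

Section Ewis.

Variables (T : nat -> nat -> nat) (h : nat -> nat).

Let v (b : nat * nat) := T b.1 b.2.
Let bots a k := [seq (j, h j) | j <- iota a k & 0 < h j].

Let botsS a k : bots a k.+1 =
  if 0 < h a then (a, h a) :: bots a.+1 k else bots a.+1 k.
Proof. by rewrite /bots /=; case: ifP. Qed.

Lemma mem_ewis_from x a k c r :
  ((c, r) \in ewis_from v x (bots a k)) =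
  [&& a <= c < a + k, 0 < h c, r == h c &
      maxn (v x) (\max_(a <= i < c) bot T h i) <= T c (h c)].
Proof.
elim: k a x => [|k IH] a x /=; first by rewrite in_nil; lia.
have split_max : a < c -> \max_(a <= i < c) bot T h i =
    maxn (bot T h a) (\max_(a.+1 <= i < c) bot T h i) by move=> ac; rewrite big_ltn.
rewrite botsS; case: posnP => ha.
  rewrite IH; case: (ltngtP a c) => ac /=; rewrite ?addSnnS //.
    by rewrite split_max // /bot ha /= max0n.
  by rewrite -ac ha andbF.
have hx : bot T h a = v (a, h a) by rewrite /bot ha.
rewrite /=; case: (leqP (v x) (v (a, h a))) => hv; rewrite ?in_cons IH ?xpair_eqE; case: (ltngtP a c) => ac //=.
- by rewrite addSnnS split_max // hx maxnA (maxn_idPr hv).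
- rewrite -ac ha big_geq // maxn0 -[T a _]/(v (a, h a)) hv.
  by rewrite orbF andbT; lia.
- by rewrite addSnnS split_max // hx maxnA (maxn_idPl (ltnW hv)).
- have nv : (v x <= v (a, h a)) = false by rewrite leqNgt hv.
  by rewrite -ac big_geq // maxn0 -[T a _]/(v (a, h a)) nv !andbF.
Qed.

(** The members of an EWIS are the weak left-to-right maxima. *)
Lemma mem_ewis a k c r :
  ((c, r) \in ewis v (bots a k)) =
  [&& a <= c < a + k, 0 < h c, r == h c & \max_(a <= i < c) bot T h i <= T c (h c)].
Proof.
elim: k a => [|k IH] a; first by rewrite in_nil; lia.
rewrite botsS; case: posnP => ha.
  rewrite IH; case: (ltngtP a c) => ac /=; rewrite ?addSnnS //.
    by rewrite (big_ltn ac) /bot ha /= max0n.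
  by rewrite -ac ha andbF.
rewrite /= in_cons mem_ewis_from xpair_eqE; case: (ltngtP a c) => ac //=.
  by rewrite addSnnS (big_ltn ac) {2}/bot ha.
by rewrite -ac ha big_geq //= andbT orbF; lia.
Qed.

Lemma last_ewis_from x a k l :
  v (last x [seq b <- ewis_from v x (bots a k) | b.1 < l]) =
  maxn (v x) (\max_(a <= i < minn l (a + k)) bot T h i).
Proof.
elim: k a x => [|k IH] a x; first by rewrite big_geq ?maxn0 //; lia.
have [la|al] := leqP l a.
  rewrite big_geq; last lia.
  rewrite (@eq_in_filter _ _ pred0) ?filter_pred0 ?maxn0 // => -[c r].
  by rewrite mem_ewis_from => /and4P[hc _ _ _] /=; lia.
have hm : a < minn l (a + k.+1) by lia.
rewrite (big_ltn hm) -addSnnS.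
rewrite botsS; case: posnP => ha.
  by rewrite IH [in RHS]/bot ha /= max0n.
have hx : bot T h a = v (a, h a) by rewrite /bot ha.
rewrite /= hx; case: leqP => hv /=; rewrite ?al /= IH maxnA.
  by rewrite (maxn_idPr hv).
by rewrite (maxn_idPl (ltnW hv)).
Qed.

Lemma last_ewis a k l j : a <= j < a + k -> j < l -> 0 < h j ->
  v (last (0, 0) [seq b <- ewis v (bots a k) | b.1 < l]) =
  \max_(a <= i < minn l (a + k)) bot T h i.
Proof.
elim: k a => [|k IH] a hj jl hh; first by lia.
have hm : a < minn l (a + k.+1) by lia.
have al : a < l by lia.
rewrite (big_ltn hm) -addSnnS botsS; case: posnP => ha.
  rewrite [in RHS]/bot ha /= max0n IH //.
  have : a != j by apply: contraTneq hh => <-; rewrite ha.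
  lia.
by rewrite /= al /= last_ewis_from [bot T h a]/bot ha.
Qed.

End Ewis.

Section Scanning.

Variables (n : nat) (lam : seq nat) (T : nat -> nat -> nat).
Hypotheses (hlam : is_partition lam) (hT : semistandard n lam T).

Local Notation m := (ncols lam).
Local Notation zeta := (col_len lam).

Lemma col_len_gt0 c : 0 < c -> (0 < zeta c) = (c <= m).
Proof. by move=> c0; have := in_shapeE c 1 hlam; rewrite /in_shape /row_len /= nth0 c0. Qed.

Lemma in_skew_nil c r : in_skew [::] lam c r = [&& 0 < c, 0 < r & r <= zeta c].
Proof.
by rewrite /in_skew in_shapeE // /in_shape /row_len nth_nil; lia.
Qed.

Lemma tab_range c r : 0 < c -> 0 < r <= zeta c -> 0 < T c r <= n.
Proof.
move=> c0 hr; have hs : in_skew [::] lam c r by rewrite in_skew_nil c0.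
by have [] := hT hs.
Qed.

Lemma tab_row c r : 0 < c -> 0 < r <= zeta c.+1 -> T c r <= T c.+1 r.
Proof.
move=> c0 hr; have hz := col_len_mono lam (leqnSn c).
have hs : in_skew [::] lam c r by rewrite in_skew_nil; lia.
by have [_ h _] := hT hs; apply: h; rewrite in_skew_nil.
Qed.

Lemma tab_col c r r' : 0 < c -> 0 < r -> r < r' -> r' <= zeta c -> T c r < T c r'.
Proof.
move=> c0 r0; elim: r' => // r' IH; rewrite ltnS => hr hz.
have lt : T c r' < T c r'.+1.
  have hs : in_skew [::] lam c r' by rewrite in_skew_nil; lia.
  by have [_ _ h] := hT hs; apply: h; rewrite in_skew_nil; lia.
have [->//|ne] := eqVneq r r'.
by apply: ltn_trans (IH _ _) lt; lia.
Qed.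

Lemma tab_col_le c r r' : 0 < c -> 0 < r -> r <= r' -> r' <= zeta c -> T c r <= T c r'.
Proof.
move=> c0 r0; rewrite leq_eqVlt => /orP[/eqP ->//|h] hz.
by apply: ltnW; apply: tab_col.
Qed.

Section Path.

Variable l : nat.
Hypothesis hl : 0 < l.

Local Notation H := (scan_heights lam T l).
Local Notation y t c := (bots_max T (H t) c).

Definition taken (t c : nat) : bool :=
  [&& 0 < c <= m, 0 < H t c & y t c <= T c (H t c)].

Lemma mem_scan t c r : ((c, r) \in scan lam T (H t)) = (r == H t c) && taken t c.
Proof.
rewrite /scan /bottoms mem_ewis /taken add1n ltnS.
by case: (r == _); rewrite ?andbF.
Qed.

Lemma heightsS t c : H t.+1 c = H t c - taken t c.
Proof. by rewrite /= mem_scan eqxx. Qed.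

Lemma heights_le t t' c : t <= t' -> H t' c <= H t c.
Proof.
move=> /subnKC <-; elim: (t' - t) => [|k IH]; first by rewrite addn0.
by rewrite addnS heightsS; apply: leq_trans IH; apply: leq_subr.
Qed.

Lemma heights_zeta t c : H t c <= zeta c.
Proof. by apply: leq_trans (heights_le c (leq0n t)) _; rewrite /=; case: ifP. Qed.

Lemma heights_before t c : c < l -> H t c = 0.
Proof. by move=> cl; have := heights_le c (leq0n t); rewrite /= cl; lia. Qed.

Lemma bots_maxS t c : 0 < c -> y t c.+1 = maxn (y t c) (bot T (H t) c).
Proof. by move=> c0; rewrite /bots_max big_nat_recr. Qed.

Lemma bots_max_le t c x : (forall i, 0 < i -> i < c -> 0 < H t i -> T i (H t i) <= x) ->
  y t c <= x.
Proof.
move=> h; apply/bigmax_leqP_seq => i; rewrite mem_index_iota => /andP[i0 ic] _.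
by rewrite /bot; case: posnP => // hi; apply: h.
Qed.

Lemma le_bots_max t i c : 0 < i -> i < c -> 0 < H t i -> T i (H t i) <= y t c.
Proof.
move=> i0 ic hi; have -> : T i (H t i) = bot T (H t) i by rewrite /bot hi.
by apply: (leq_bigmax_seq (F := bot T (H t))) => //; rewrite mem_index_iota i0.
Qed.

Lemma bots_max_mono t c c' : c <= c' -> y t c <= y t c'.
Proof. by move=> h; apply: bots_max_le => i i0 ic; apply: le_bots_max => //; lia. Qed.

(** Scanning keeps the remaining boxes a partition: when two adjacent columns
    have the same height and the first loses its bottom, the EWIS goes on to
    the bottom of the second. *)
Lemma heights_noninc t c : l <= c -> H t c.+1 <= H t c.
Proof.
move=> lc; have c0 : 0 < c by lia.
elim: t => [|t IH]; first by rewrite /= !ltnNge lc (leqW lc) /= col_len_mono.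
rewrite !heightsS; have [lt|e] : H t c.+1 < H t c \/ H t c.+1 = H t c by lia.
  by case: (taken t c); case: (taken t c.+1); lia.
suff : taken t c -> taken t c.+1.
  by rewrite e; case: (taken t c); case: (taken t c.+1) => h; try lia; have := h isT.
case/and3P=> hc h1 h2; have hz := heights_zeta t c.+1.
rewrite /taken e h1 -col_len_gt0 //= bots_maxS // /bot h1 geq_max.
have le : T c (H t c) <= T c.+1 (H t c) by apply: tab_row => //; lia.
by rewrite (leq_trans h2 le) le /=; lia.
Qed.

Lemma heights_noninc_le t c c' : l <= c -> c <= c' -> H t c' <= H t c.
Proof.
move=> lc /subnKC <-; elim: (c' - c) => [|k IH]; first by rewrite addn0.
by rewrite addnS; apply: leq_trans (heights_noninc _ _) IH; lia.
Qed.

Lemma bots_max_first t c : c <= l -> y t c = 0.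
Proof.
move=> cl; apply/eqP; rewrite -leqn0; apply: bots_max_le => i i0 ic.
by rewrite heights_before //; lia.
Qed.

Lemma heights_first t : H t l = zeta l - t.
Proof.
elim: t => [|t IH]; first by rewrite /= ltnn subn0.
rewrite heightsS IH /taken IH bots_max_first // hl /=.
case: (posnP (zeta l - t)) => h; first by rewrite andbF; lia.
by rewrite -col_len_gt0 // ; have -> : 0 < zeta l by [lia]; lia.
Qed.

Lemma heights_end t c : zeta l <= t -> H t c = 0.
Proof.
move=> ht; have [/heights_before//|lc] := ltnP c l.
by have := heights_noninc_le t (leqnn l) lc; rewrite heights_first; lia.
Qed.

Lemma taken_first t : t < zeta l -> taken t l.
Proof.
move=> ht; rewrite /taken bots_max_first // heights_first hl -col_len_gt0 //.
by lia.
Qed.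

Lemma taken_lt t c : taken t c -> t < zeta l.
Proof.
by move=> h; rewrite ltnNge; apply/negP => /heights_end h0; move: h; rewrite /taken h0 andbF.
Qed.

(** The height of the column decreases from its full length to 0 in steps of at
    most one, so at some time it loses the box in row [r]. *)
Lemma taken_ex c r : l <= c -> 0 < r <= zeta c -> exists t, H t c = r /\ taken t c.
Proof.
move=> lc hr.
have ex : exists t, H t c < r by exists (zeta l); rewrite heights_end; lia.
case: (ex_minnP ex) => -[|t] ht mt; first by move: ht; rewrite /= [c < l]ltnNge lc /=; lia.
exists t; have h1 : r <= H t c by rewrite leqNgt; apply/negP => /mt; lia.
by move: ht; rewrite heightsS; case: (taken t c); split=> //; lia.
Qed.

Lemma taken_lt_height t t' c : taken t c -> t < t' -> H t' c < H t c.
Proof.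
move=> h tt; have := heights_le c tt; rewrite heightsS h.
by case/and3P: h => _ h _; lia.
Qed.

Lemma taken_inj t t' c : taken t c -> taken t' c -> H t c = H t' c -> t = t'.
Proof.
move=> h h' e; case: (ltngtP t t') => // lt.
  by have := taken_lt_height h lt; lia.
by have := taken_lt_height h' lt; lia.
Qed.

Lemma bots_max_gt0 t c : l < c -> t < zeta l -> 0 < y t c.
Proof.
move=> lc ht; have hh : 0 < H t l by rewrite heights_first; lia.
apply: leq_trans (le_bots_max hl lc hh).
by have := @tab_range l (H t l) hl; rewrite heights_zeta hh => /(_ isT); lia.
Qed.

Lemma bots_max_bound t c : y t c <= n.
Proof.
apply: bots_max_le => i i0 ic hi.
by have := @tab_range i (H t i) i0; rewrite heights_zeta hi => /(_ isT); lia.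
Qed.

(** Later paths carry smaller values: the bottom of a column has either moved
    up, or it was below the value that the earlier path carried past it. *)
Lemma bots_max_desc t t' c : l < c -> t < t' -> t' < zeta l -> y t' c < y t c.
Proof.
move=> lc; elim: t' => // t' IH; rewrite ltnS => tt ht'.
have lt : y t'.+1 c < y t' c.
  have y0 : 0 < y t' c by apply: bots_max_gt0; lia.
  rewrite -(prednK y0) ltnS; apply: bots_max_le => i i0 ic hi.
  rewrite -ltnS prednK //; move: hi; rewrite heightsS.
  have hz := heights_zeta t' i.
  case hk: (taken t' i) => hi; last first.
    rewrite subn0 in hi *; move: hk; rewrite /taken hi i0 -col_len_gt0 //.
    have -> /= : 0 < zeta i by lia.
    by move/negbT; rewrite -ltnNge => h; apply: leq_trans h (bots_max_mono _ _); lia.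
  apply: leq_trans (le_bots_max (t := t') i0 ic _); last lia.
  by apply: tab_col; lia.
have [->//|ne] := eqVneq t t'.
by apply: ltn_trans lt (IH _ _); lia.
Qed.

Lemma bots_max_inj t t' c : l < c -> t < zeta l -> t' < zeta l -> y t c = y t' c -> t = t'.
Proof.
move=> lc ht ht' e; case: (ltngtP t t') => // lt.
  by have := bots_max_desc lc lt ht'; lia.
by have := bots_max_desc lc lt ht; lia.
Qed.

Lemma bots_max_next t c : 0 < c <= m ->
  y t c.+1 = if taken t c then T c (H t c) else y t c.
Proof.
move=> /andP[c0 cm]; rewrite bots_maxS // /taken c0 cm /bot /=.
case: (posnP (H t c)) => [_|_] /=; first by rewrite maxn0.
by case: leqP.
Qed.

(** ** Exchanging a column with the one after it *)

(** The values with which the paths arrive at column [c]; for [c = l.+1] these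
    are the entries of column [l]. *)
Definition path_vals (c : nat) : nat -> bool :=
  value_set (fun t => if t < zeta l then Some (y t c) else None).

(** The part of these values that stays on the left when the travelling column
    is exchanged with column [c]: those of the paths that use column [c]. *)
Definition taken_vals (c : nat) : nat -> bool :=
  value_set (fun t => if taken t c then Some (y t c) else None).

Definition tab_cols : matrix := cols (to_filling [::] lam T).

Lemma tab_cols_taken c : l <= c ->
  tab_cols c = value_set (fun t => if taken t c then Some (T c (H t c)) else None).
Proof.
move=> lc; apply/funext=> v; apply/value_setP/value_setP=> [[r]|[t]].
  rewrite /to_filling in_skew_nil; case: ifP => // /and3P[_ r0 rz] [<-].
  have [|t [ht hk]] := @taken_ex c r lc; first lia.
  by exists t; rewrite hk ht.
case: ifP => // hk [<-]; exists (H t c).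
by rewrite /to_filling in_skew_nil heights_zeta; case/and3P: hk => /andP[-> _] ->.
Qed.

Section Exchange.

Variable c : nat.
Hypotheses (lc : l < c) (cm : c <= m).

Let c_range : 0 < c <= m. Proof. by rewrite cm; lia. Qed.

(* Halfway through the exchange: the values of the unused paths with index
   below s have already moved to the left. *)
Let fA s t := if (t < zeta l) && (taken t c || (t < s)) then Some (y t c) else None.
Let fB s t := if (t < zeta l) && (taken t c || (s <= t)) then Some (y t c.+1) else None.

Let next_taken t : taken t c -> y t c <= y t c.+1.
Proof. by move=> h; rewrite bots_max_next // h; case/and3P: h. Qed.

(** The value of an unused path separates the remaining entries of the column
    from those already used, so below and above it the paths using the column
    match their entries one to one. *)
Let unused_split s t : s < zeta l -> ~~ taken s c -> taken t c ->
  (y t c <= y s c) = (y t c.+1 <= y s c).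
Proof.
move=> hs ns ht; have tp := taken_lt ht.
have := next_taken ht; case: (ltngtP s t) => st.
- have := bots_max_desc lc st tp; rewrite [y t c.+1]bots_max_next // ht.
  have [_ h0 _] := and3P ht; have hh := heights_le c (ltnW st).
  have le : T c (H t c) <= T c (H s c).
    by apply: tab_col_le; rewrite ?heights_zeta //; lia.
  move: ns; rewrite /taken c_range /=; have -> /= : 0 < H s c by lia.
  by rewrite -ltnNge; lia.
- by have := bots_max_desc lc st hs; lia.
- by move: ns; rewrite st ht.
Qed.

Let cntA s v : cnt (value_set (fA s)) v = \sum_(t < zeta l) value_le v (fA s t).
Proof.
apply: cnt_value_set => [t w|t t' w]; rewrite /fA; case: ifP => // /andP[tp _].
  by case=> <-; rewrite tp bots_max_gt0.
by case=> <-; case: ifP => // /andP[tp' _] [] /esym; apply: bots_max_inj.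
Qed.

Let cntB s v : cnt (value_set (fB s)) v = \sum_(t < zeta l) value_le v (fB s t).
Proof.
apply: cnt_value_set => [t w|t t' w]; rewrite /fB; case: ifP => // /andP[tp _].
  by case=> <-; rewrite tp bots_max_gt0 //; lia.
by case=> <-; case: ifP => // /andP[tp' _] [] /esym; apply: bots_max_inj => //; lia.
Qed.

Let raising_unused s : s < zeta l -> ~~ taken s c ->
  raising (value_set (fA s)) (value_set (fB s)) (y s c).
Proof.
move=> hs ns.
have key v : \sum_(t < zeta l) (value_le v (fB s t) + value_le (y s c) (fA s t)
      + (v < y s c) * (t == s :> nat)) <=
    \sum_(t < zeta l) (value_le (y s c) (fB s t) + value_le v (fA s t)).
  apply: leq_sum => -[t /= tp] _; rewrite /fA /fB tp /=.
  case ht: (taken t c) => /=.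
    have := unused_split hs ns ht; have := next_taken ht.
    have -> : (t == s) = false by apply: contraNF ns => /eqP <-.
    by lia.
  have e : y t c.+1 = y t c by rewrite bots_max_next // ht.
  case: (ltngtP t s) => ts /=.
  - by have := bots_max_desc lc ts hs; lia.
  - by rewrite e; have := bots_max_desc lc ts tp; lia.
  - by rewrite e ts; lia.
have key' v : cnt (value_set (fB s)) v + cnt (value_set (fA s)) (y s c) + (v < y s c) <=
    cnt (value_set (fB s)) (y s c) + cnt (value_set (fA s)) v.
  have := key v; rewrite !big_split /= (@sum_delta (zeta l) s (fun _ => v < y s c)) //.
  by rewrite !cntA !cntB.
split=> [|v hv|v]; first exact: bots_max_gt0.
  by have := key' v; rewrite hv; lia.
by have := key' v; lia.
Qed.

Let fA_step s : s < zeta l -> ~~ taken s c ->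
  value_set (fA s.+1) = add_val (value_set (fA s)) (y s c).
Proof.
move=> hs ns; apply/funext=> v; rewrite /add_val.
apply/value_setP/orP=> [[t]|[/value_setP[t]|/eqP ->]]; rewrite /fA.
- case: ifP => // /andP[tp ht] [<-].
  case: (eqVneq t s) => [->|ts]; [by right|left].
  by apply/value_setP; exists t; rewrite tp; have -> : taken t c || (t < s) by lia.
- by case: ifP => // /andP[tp ht] [<-]; exists t; rewrite tp; have -> : taken t c || (t < s.+1) by lia.
- by exists s; rewrite hs ltnSn orbT.
Qed.

Let fB_step s : s < zeta l -> ~~ taken s c ->
  value_set (fB s.+1) = rem_val (value_set (fB s)) (y s c).
Proof.
move=> hs ns; have e : y s c.+1 = y s c by rewrite bots_max_next // (negPf ns).
apply/funext=> v; rewrite /rem_val.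
apply/value_setP/andP=> [[t]|[/value_setP[t]]]; rewrite /fB.
- case: ifP => // /andP[tp ht] [<-]; split.
    by apply/value_setP; exists t; rewrite tp; have -> : taken t c || (s <= t) by lia.
  apply/eqP; rewrite -e => /bots_max_inj ets.
  have et : t = s by apply: ets => //; lia.
  by move: ht; rewrite et (negPf ns) ltnn.
- case: ifP => // /andP[tp ht] [<-] hv; exists t; rewrite tp.
  have -> : taken t c || (s < t) => //.
  have : t != s by apply: contraNneq hv => ->; rewrite e.
  by lia.
Qed.

Let same_step s : taken s c -> fA s.+1 = fA s /\ fB s.+1 = fB s.
Proof.
move=> hk; split; apply/funext=> t; rewrite /fA /fB.
  by case: (eqVneq t s) => [->|ts]; rewrite ?hk //; have -> : (t < s.+1) = (t < s) by lia.
by case: (eqVneq t s) => [->|ts]; rewrite ?hk //; have -> : (s < t) = (s <= t) by lia.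
Qed.

(** Exchanging two columns: the values of the paths that skip column [c]
    belong to both the arriving and the departing column of path values.
    Starting from the departing one, raising moves bring these values back to
    the left, the largest first, and column [c] remains. *)
Lemma exchange (J : nat -> bool) (M N : matrix) : J c.-1 ->
  M c.-1 = taken_vals c -> M c = path_vals c.+1 ->
  N c.-1 = path_vals c -> N c = tab_cols c ->
  (forall k, k != c.-1 -> k != c -> M k = N k) -> raises J M N.
Proof.
move=> Jc M1 M2 N1 N2 MN; have cc : c.-1.+1 = c by lia.
pose St s : matrix := fun k => if k == c.-1 then value_set (fA s)
  else if k == c then value_set (fB s) else M k.
have St1 s : St s c.-1 = value_set (fA s) by rewrite /St eqxx.
have St2 s : St s c = value_set (fB s).
  by rewrite /St eqxx; have -> : (c == c.-1) = false by lia.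
have hst s : s <= zeta l -> raises J (St 0) (St s).
  elim: s => [|s IH] hs; first exact: raises0.
  apply: raises_trans (IH (ltnW hs)) _.
  case hk: (taken s c).
    have [eA eB] := same_step hk; rewrite /St eA eB; exact: raises0.
  have hr := raising_unused hs (negbT hk).
  have -> : St s.+1 = move_val c.-1 (y s c) (St s).
    apply/funext=> k; have [->|k1] := eqVneq k c.-1.
      by rewrite move_val_l !St1 fA_step ?hk.
    have [->|k2] := eqVneq k c.
      by have := move_val_r c.-1 (y s c) (St s); rewrite cc => ->; rewrite !St2 fB_step ?hk.
    by rewrite move_val_out ?cc // /St (negPf k1) (negPf k2).
  by apply: raises1 => //; [lia|rewrite cc St1 St2].
have eM : St 0 = M.
  apply/funext=> k; rewrite /St; case: eqP => [->|_].
    rewrite M1 /taken_vals; congr value_set; apply/funext=> t; rewrite /fA ltn0 orbF.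
    by case hk: (taken t c); rewrite ?andbF // (taken_lt hk).
  case: eqP => [->|_] //; rewrite M2 /path_vals; congr value_set; apply/funext=> t.
  by rewrite /fB leq0n orbT andbT.
have eN : St (zeta l) = N.
  apply/funext=> k; rewrite /St; case: eqP => [->|/eqP k1].
    rewrite N1 /path_vals; congr value_set; apply/funext=> t; rewrite /fA.
    by case: (t < zeta l); rewrite ?orbT.
  case: eqP => [->|/eqP k2]; last exact: MN.
  rewrite N2 tab_cols_taken ?(ltnW lc) //; congr value_set; apply/funext=> t; rewrite /fB.
  case: (ltnP t (zeta l)) => tp; last by case: ifP => // /taken_lt; lia.
  rewrite orbF /=; case: ifP => // hk; by rewrite bots_max_next // hk.
by rewrite -eM -eN; apply: hst.
Qed.

End Exchange.

Lemma path_vals_first : path_vals l.+1 = tab_cols l.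
Proof.
rewrite tab_cols_taken //; congr value_set; apply/funext=> t.
case: (ltnP t (zeta l)) => tp; last by case: ifP => // /taken_lt; lia.
have hk := taken_first tp; rewrite hk bots_max_next ?hk //.
by have [] := and3P hk.
Qed.

(** The columns of the tableau after column [l] has been exchanged with the
    columns [l.+1], ..., [c]. *)
Definition moved_to (c : nat) : matrix := fun k =>
  if (l <= k) && (k < c) then taken_vals k.+1
  else if k == c then path_vals c.+1 else tab_cols k.

Lemma moved_to_raises c : l <= c <= m -> raises everywhere (moved_to c) tab_cols.
Proof.
move=> /andP[]; elim: c => [|c IH] lc cm; first lia.
have e0 : moved_to l = tab_cols.
  apply/funext=> k; rewrite /moved_to; have -> : (l <= k) && (k < l) = false by lia.
  by case: eqP => // ->; rewrite path_vals_first.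
have [e|lc'] := eqVneq l c.+1; first by rewrite -e e0; apply: raises0.
apply: raises_trans (IH _ _); try lia.
apply: (@exchange c.+1) => //=; try lia; rewrite /moved_to.
- by have -> : (l <= c) && (c < c.+1) by lia.
- by rewrite ltnn andbF eqxx.
- by rewrite ltnn andbF eqxx.
- have -> : (l <= c.+1) && (c.+1 < c) = false by lia.
  by have -> : (c.+1 == c) = false by lia.
- move=> k k1 k2; have -> : (k < c.+1) = (k < c) by lia.
  by rewrite (negPf k1) (negPf k2).
Qed.

End Path.

End Scanning.

(** * Columns of a filling as sorted lists *)

Definition col_list (P : filling) (a b : nat -> nat) (c : nat) : seq nat :=
  [seq odflt 0 (P c r) | r <- iota (a c).+1 (b c - a c)].

Lemma sorted_map_ltn (f : nat -> nat) a k :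
  (forall r, a <= r -> r.+1 < a + k -> f r < f r.+1) ->
  sorted ltn [seq f r | r <- iota a k].
Proof.
elim: k a => [|[|k] IH] a h //=; rewrite h //=; last lia.
by apply: (IH a.+1) => r h1 h2; apply: h; lia.
Qed.

Lemma ltn_sorted_eq (s s' : seq nat) : sorted ltn s -> sorted ltn s' -> s =i s' -> s = s'.
Proof. by apply: irr_sorted_eq; [apply: ltn_trans|apply: ltnn]. Qed.

Section FilledShape.

Variables (n m : nat) (a b : nat -> nat) (P : filling).
Hypotheses (hab : nested m a b) (hP : fills a b P).
Hypotheses (ssP : semistd P) (enP : entries_in n P).

Let P_mem c r : 0 < c -> a c < r <= b c -> exists v, P c r = Some v.
Proof. by move=> c0 hr; apply: isSome_ex; rewrite hP c0. Qed.

Let P_supp c r v : P c r = Some v -> 0 < c /\ a c < r <= b c.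
Proof. by move=> e; have := hP c r; rewrite e => /esym/andP. Qed.

Lemma col_list_sorted c : 0 < c -> sorted ltn (col_list P a b c).
Proof.
move=> c0; apply: sorted_map_ltn => r h1 h2.
have [u hu] : exists u, P c r = Some u by apply: P_mem; lia.
have [w hw] : exists w, P c r.+1 = Some w by apply: P_mem; lia.
rewrite hu hw /=.
by have [_] := ssP (leqnn c) (leqnSn r) hu hw; apply.
Qed.

Lemma mem_col_list c v : 0 < c -> (v \in col_list P a b c) = cols P c v.
Proof.
move=> c0; apply/mapP/value_setP => [[r]|[r hr]].
  rewrite mem_iota => hr ->; have [|u hu] := @P_mem c r c0; first lia.
  by exists r; rewrite hu.
exists r; last by rewrite hr.
by have [_] := P_supp hr; rewrite mem_iota; lia.
Qed.

Lemma supported_cols : supported m n (cols P).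
Proof.
move=> c v /value_setP[r hr]; rewrite (enP hr) andbT.
have [c0 h] := P_supp hr; rewrite c0 leqNgt; apply/negP => hc.
by case: hab => _ _ _ /(_ c hc); lia.
Qed.

Lemma cnt_cols c t N : b c < N -> cnt (cols P c) t = \sum_(r < N) value_le t (P c r).
Proof.
move=> hN; apply: cnt_value_set => [r w hr|r r' w]; last exact: semistd_inj.
by have [_ h] := P_supp hr; have := enP hr; lia.
Qed.

Lemma weight_cols c : 0 < c -> weight n (cols P) c = b c - a c.
Proof.
move=> c0; have hle : a c <= b c by case: hab => _ _ h _; apply: h.
rewrite /weight (@cnt_cols _ _ (b c).+1) //.
have e N : \sum_(r < N.+1) (a c < r <= b c) = minn N (b c) - a c.
  elim: N => [|N IH]; first by rewrite big_ord_recr big_ord0 /=; lia.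
  by rewrite big_ord_recr /= IH; case: (boolP (a c < N.+1 <= b c)) => h /=; lia.
rewrite -[in RHS](minnn (b c)) -e; apply: eq_bigr => -[r /= _] _.
have := hP c r; rewrite c0 /=; case E: (P c r) => [w|] /= <- //.
by have := enP E; case: (leqP w n); lia.
Qed.

Lemma highest_straight : (forall c, 0 < c -> a c = 0) -> highest everywhere (cols P).
Proof.
move=> a0 j t _ j0; case: hab => _ nb _ _; have bj := nb j j0.
rewrite !(@cnt_cols _ _ (b j).+1) //; apply: leq_sum => -[r /= _] _.
case E: (P j.+1 r) => [w|] //=; have [_ hr] := P_supp E.
have [|u hu] := @P_mem j r j0; first by rewrite a0 //; lia.
have [h _] := ssP (leqnSn j) (leqnn r) hu E.
by rewrite hu /=; case: (leqP w t) => // /(leq_trans h) ->.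
Qed.

End FilledShape.

(** Column sets determine a filling of straight shape: the cardinalities give
    the shape, and each column is sorted. *)
Lemma straight_unique n m b b' P P' : nested m (fun _ => 0) b -> nested m (fun _ => 0) b' ->
  fills (fun _ => 0) b P -> fills (fun _ => 0) b' P' -> semistd P -> semistd P' ->
  entries_in n P -> entries_in n P' -> cols P = cols P' -> P = P'.
Proof.
move=> nb nb' hP hP' ss ss' en en' e; apply/funext=> c; apply/funext=> r.
have := hP c r; have := hP' c r; case: (posnP c) => [->|c0] /=.
  by case: (P 0 r); case: (P' 0 r).
have bb : b c = b' c.
  have := weight_cols nb hP ss en c0; have := weight_cols nb' hP' ss' en' c0.
  by rewrite e; lia.
have el : col_list P (fun _ => 0) b c = col_list P' (fun _ => 0) b' c.
  apply: ltn_sorted_eq.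
  - exact: (col_list_sorted hP ss).
  - exact: (col_list_sorted hP' ss').
  - by move=> v; rewrite (mem_col_list hP) // (mem_col_list hP') // e.
rewrite -bb; case: (boolP (0 < r <= b c)) => hr; last by case: (P c r); case: (P' c r).
have h (Q : filling) : odflt 0 (Q c r) = nth 0 [seq odflt 0 (Q c r) | r <- iota 1 (b c)] r.-1.
  rewrite (nth_map 0) ?size_iota; last lia.
  by rewrite nth_iota; [congr (odflt 0 (Q c _))|]; lia.
have := h P; have := h P'; move: el; rewrite /col_list !subn0 -bb => -> <-.
by case: (P c r) => [u|]; case: (P' c r) => [u'|] //= ->.
Qed.

Lemma in_skewE mu nu c r : is_partition mu -> is_partition nu ->
  in_skew mu nu c r = (0 < c) && (col_len mu c < r <= col_len nu c).
Proof. by move=> pmu pnu; rewrite /in_skew !in_shapeE //; lia. Qed.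

Lemma to_filling_semistd n mu nu S : is_partition mu -> is_partition nu ->
  skew_semistandard n mu nu S ->
  semistd (to_filling mu nu S) /\ entries_in n (to_filling mu nu S).
Proof.
move=> pmu pnu hS; split; last first.
  by move=> c r v; rewrite /to_filling; case: ifP => // /hS[h _ _] [<-].
have row k c r : in_skew mu nu c r -> in_skew mu nu (c + k) r -> S c r <= S (c + k) r.
  elim: k => [|k IH]; first by rewrite addn0.
  rewrite addnS => h1 h2; have h3 : in_skew mu nu (c + k) r.
    move: h1 h2; rewrite !in_skewE //.
    have := col_len_mono nu (leqnSn (c + k)); have := col_len_mono mu (leq_addr k c).
    by lia.
  by have [_ h _] := hS _ _ h3; apply: leq_trans (IH h1 h3) (h h2).
have col k c r : in_skew mu nu c r -> in_skew mu nu c (r + k.+1) -> S c r < S c (r + k.+1).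
  elim: k => [|k IH] h1.
    by rewrite addn1 => h2; have [_ _ h] := hS _ _ h1; apply: h.
  rewrite addnS => h2; have h3 : in_skew mu nu c (r + k.+1).
    by move: h1 h2; rewrite !in_skewE //; lia.
  by have [_ _ h] := hS _ _ h3; apply: ltn_trans (IH h1 h3) (h h2).
move=> c r c' r' u w hc hr; rewrite /to_filling; case: ifP => // h1 [<-]; case: ifP => // h2 [<-].
have h3 : in_skew mu nu c' r.
  move: h1 h2; rewrite !in_skewE //.
  by have := col_len_mono mu hc; lia.
have rr : S c r <= S c' r by rewrite -(subnKC hc) in h3 *; apply: row.
have [e|lt] : r = r' \/ r < r' by lia.
  by split; [rewrite -e|lia].
have : S c' r < S c' r'.
  have e : r' = r + (r' - r).-1.+1 by lia.
  by rewrite e; apply: col => //; rewrite -e.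
by move=> h; split; lia.
Qed.

(** * Skew tableaux with prescribed columns *)

Lemma col_len_rows_of m a c : (forall c, 0 < c -> a c.+1 <= a c) ->
  (forall c, m < c -> a c = 0) -> 0 < c -> col_len (rows_of m a) c = a c.
Proof.
move=> ha hz c0; have h i : 0 < i -> (i <= col_len (rows_of m a) c) = (i <= a c).
  move=> i0; have := in_rows_of c i ha hz.
  by rewrite in_shapeE ?rows_of_partition // i0 c0.
apply/eqP; rewrite eqn_leq; apply/andP; split.
  by case: (posnP (col_len (rows_of m a) c)) => [->//|h0]; rewrite -h.
by case: (posnP (a c)) => [->//|h0]; rewrite h.
Qed.

(** Placing each column entirely above the one to its left, any sequence of
    nonempty columns is a skew tableau. *)
Lemma skew_of_columns n m (Z : matrix) : 0 < m -> supported m n Z ->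
  (forall c, 0 < c <= m -> 0 < weight n Z c) ->
  exists mu nu S, [/\ is_skew_shape mu nu, skew_semistandard n mu nu S,
    cols (to_filling mu nu S) = Z & ncols nu = m].
Proof.
move=> m0 hZ hw; pose off c := \sum_(c <= i < m.+1) weight n Z i.
have off_rec c : c <= m -> off c = weight n Z c + off c.+1.
  by move=> hc; rewrite /off big_ltn.
have off0 c : m < c -> off c = 0 by move=> hc; rewrite /off big_geq.
have nb c : 0 < c -> off c.+1 <= off c.
  move=> _; case: (leqP c m) => hc; first by rewrite (off_rec c) // leq_addl.
  by rewrite off0 //; lia.
have na c : 0 < c -> off c.+2 <= off c.+1 by move=> _; apply: nb.
have az c : m < c -> off c.+1 = 0 by move=> hc; apply: off0; lia.
pose mu := rows_of m (fun c => off c.+1); pose nu := rows_of m off.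
pose zs c := [seq v <- iota 1 n | Z c v].
pose S c r := nth 0 (zs c) (r - off c.+1).-1.
have pmu : is_partition mu := rows_of_partition _ _.
have pnu : is_partition nu := rows_of_partition _ _.
have skE c r : in_skew mu nu c r = (0 < c) && (off c.+1 < r <= off c).
  rewrite in_skewE //; case: (posnP c) => //= c0.
  by rewrite !col_len_rows_of.
have size_zs c : size (zs c) = weight n Z c by rewrite size_filter.
have mem_zs c v : (v \in zs c) = Z c v.
  rewrite mem_filter mem_iota; case E: (Z c v) => //=; have := hZ _ _ E; lia.
have sk_range c r : in_skew mu nu c r -> (r - off c.+1).-1 < size (zs c) /\ c <= m.
  rewrite skE => /andP[c0 h]; have cm : c <= m.
    by rewrite leqNgt; apply/negP => /off0; lia.
  by rewrite size_zs; have := off_rec _ cm; lia.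
have srt c : sorted ltn (zs c) by apply: sorted_filter; [apply: ltn_trans|apply: iota_ltn_sorted].
exists mu, nu, S; split.
- split=> // c r; rewrite !in_rows_of //.
  by move=> /and3P[-> c0 h]; rewrite c0 (leq_trans h (nb c c0)).
- move=> c r h; have [hs cm] := sk_range _ _ h; split.
  + have : S c r \in zs c by apply: mem_nth.
    by rewrite mem_zs => /hZ /andP[].
  + by move: h; rewrite !skE; lia.
  + move=> h'; have [hs' _] := sk_range _ _ h'.
    have := sorted_ltn_nth ltn_trans 0 (srt c) _ _ hs hs'; apply.
    by move: h h'; rewrite !skE; lia.
- apply/funext=> c; apply/funext=> v; rewrite -[RHS]mem_zs.
  apply/value_setP/(nthP 0) => [[r]|[k hk hv]].
    rewrite /to_filling; case: ifP => // h [<-]; have [hs _] := sk_range _ _ h.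
    by exists (r - off c.+1).-1.
  have hZc : Z c v by rewrite -mem_zs -hv mem_nth.
  have hc : 0 < c <= m by have := hZ _ _ hZc; lia.
  exists (off c.+1 + k.+1); rewrite /to_filling /S addKn /= hv skE.
  have := off_rec c ltac:(lia); rewrite size_zs in hk.
  by case: ifP => //; lia.
- have h c : 0 < c -> (c <= ncols nu) = (c <= m).
    move=> c0; have := in_rows_of c 1 nb off0; rewrite /in_shape /row_len /= nth0 c0 /= => ->.
    case: (leqP c m) => hc; last by rewrite off0.
    by rewrite off_rec //; have := hw c; lia.
  have := h m m0; have := h (ncols nu); lia.
Qed.

(** * The right key *)

Section RightKey.

Variables (n : nat) (lam : seq nat) (T : nat -> nat -> nat).
Hypotheses (hlam : is_partition lam) (hT : semistandard n lam T).
Variable l : nat.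
Hypothesis hl : 0 < l <= ncols lam.

Local Notation m := (ncols lam).
Local Notation zeta := (col_len lam).
Local Notation H := (scan_heights lam T l).
Local Notation y t c := (bots_max T (H t) c).

Let l0 : 0 < l. Proof. by case/andP: hl. Qed.

Let skew_nil : is_skew_shape [::] lam.
Proof. by split=> // c r; rewrite /in_shape /row_len nth_nil; lia. Qed.

Let nested_lam : nested m (fun _ => 0) zeta.
Proof. by have := nested_of_skew skew_nil. Qed.

Let fills_lam : fills (fun _ => 0) zeta (to_filling [::] lam T).
Proof. by apply: (fills_of_skew skew_nil) => c r; rewrite /to_filling; case: ifP. Qed.

Let semistd_lam : semistd (to_filling [::] lam T).
Proof. by have [] := to_filling_semistd (isT : is_partition [::]) hlam hT. Qed.

Let entries_lam : entries_in n (to_filling [::] lam T).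
Proof. by have [] := to_filling_semistd (isT : is_partition [::]) hlam hT. Qed.

Lemma tab_cols_highest : highest everywhere (tab_cols lam T).
Proof. exact: (highest_straight nested_lam fills_lam semistd_lam entries_lam). Qed.

Lemma weight_tab_cols c : 0 < c -> weight n (tab_cols lam T) c = zeta c.
Proof.
by move=> c0; rewrite (weight_cols nested_lam fills_lam semistd_lam entries_lam) // subn0.
Qed.

Lemma weight_path_vals c : l < c -> cnt (path_vals lam T l c) n = zeta l.
Proof.
move=> lc; rewrite (@cnt_value_set (zeta l)).
- transitivity (\sum_(t < zeta l) 1); last by rewrite sum_nat_const card_ord muln1.
  by apply: eq_bigr => -[t /= ht] _; rewrite ht /= (bots_max_bound hlam hT l0).
- move=> t w; case: ifP => // ht [<-].
  exact: (bots_max_gt0 hlam hT l0).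
- move=> t t' w; case: ifP => // ht [<-]; case: ifP => // ht' [] /esym.
  exact: (bots_max_inj hlam hT l0).
Qed.

Lemma weight_taken_vals c : l < c <= m -> cnt (taken_vals lam T l c) n = zeta c.
Proof.
move=> /andP[lc cm]; have c0 : 0 < c by lia.
rewrite -(weight_tab_cols c0) /weight (tab_cols_taken hlam hT l0 (ltnW lc)).
have e t : taken lam T l t c -> T c (H t c) = y t c.+1.
  by move=> h; rewrite bots_max_next ?h // c0.
rewrite !(@cnt_value_set (zeta l)).
- apply: eq_bigr => t _; case: ifP => // h /=.
  by rewrite e // !(bots_max_bound hlam hT l0).
- move=> t w; case: ifP => // h [<-]; rewrite (taken_lt hlam hT l0 h).
  exact: (bots_max_gt0 hlam hT l0 lc (taken_lt hlam hT l0 h)).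
- move=> t t' w; case: ifP => // h [<-]; case: ifP => // h' [] /esym.
  exact: (bots_max_inj hlam hT l0 lc (taken_lt hlam hT l0 h) (taken_lt hlam hT l0 h')).
- move=> t w; case: ifP => // h [<-]; rewrite e // (taken_lt hlam hT l0 h).
  by apply: (bots_max_gt0 hlam hT l0) (taken_lt hlam hT l0 h); lia.
- move=> t t' w; case: ifP => // h [<-]; case: ifP => // h' [] /esym; rewrite !e //.
  have lc1 : l < c.+1 by lia.
  exact: (bots_max_inj hlam hT l0 lc1 (taken_lt hlam hT l0 h) (taken_lt hlam hT l0 h')).
Qed.

Local Notation Z := (moved_to lam T l m).

(** Column [c] of [Z] has the length of column [src c] of the tableau. *)
Let src c := if c < l then c else if c < m then c.+1 else if c == m then l else c.

Let weight_Z c : 0 < c <= m -> weight n Z c = zeta (src c).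
Proof.
move=> hc; rewrite /weight /moved_to /src.
case: (ltnP c l) => cl /=.
  have -> : (c == m) = false by lia.
  by rewrite -/(weight n _ c) weight_tab_cols //; lia.
case: (ltnP c m) => cm /=; first by rewrite weight_taken_vals //; lia.
by have -> : c == m by [lia]; rewrite weight_path_vals //; lia.
Qed.

Let supported_Z : supported m n Z.
Proof.
move=> c v; rewrite /moved_to.
have ymem t c' : l < c' -> t < zeta l -> 0 < y t c' <= n.
  by move=> h1 h2; rewrite (bots_max_gt0 hlam hT l0) // (bots_max_bound hlam hT l0).
case: (boolP ((l <= c) && (c < m))) => hc.
  case/value_setP=> t; case: ifP => // ht [<-]; rewrite ymem ?(taken_lt hlam hT l0 ht) //; lia.
case: eqP => [->|_].
  case/value_setP=> t; case: ifP => // ht [<-]; rewrite ymem //; lia.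
exact: (supported_cols nested_lam fills_lam entries_lam).
Qed.

Let perm_Z : perm_eq (weights m n Z) (weights m n (tab_cols lam T)).
Proof.
apply: (@perm_weights m n _ _ src).
- by move=> k hk; rewrite /src; case: (ltnP k l) => ?; case: (ltnP k m) => ?; case: (eqVneq k m) => ?; lia.
- move=> k k'; rewrite !mem_iota /src => hk hk'.
  by case: (ltnP k l) => ?; case: (ltnP k m) => ?; case: (eqVneq k m) => ?;
     case: (ltnP k' l) => ?; case: (ltnP k' m) => ?; case: (eqVneq k' m) => ? /=; lia.
- move=> k hk; rewrite weight_Z // weight_tab_cols //.
  by rewrite /src; case: (ltnP k l) => ?; case: (ltnP k m) => ?; case: (eqVneq k m) => ?; lia.
Qed.

Let raises_Z : raises everywhere Z (tab_cols lam T).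
Proof. by apply: (moved_to_raises hlam hT l0); case/andP: hl => _ ->; rewrite leqnn. Qed.

Let Z_last : Z m = path_vals lam T l m.+1.
Proof. by rewrite /moved_to ltnn andbF eqxx. Qed.

Let weights_tab : weights m n (tab_cols lam T) = col_lens lam.
Proof.
by apply/eq_in_map => c; rewrite mem_iota => hc; rewrite weight_tab_cols //; lia.
Qed.

Definition scan_col : seq nat := [seq y (zeta l - k) m.+1 | k <- iota 1 (zeta l)].

Lemma scan_col_sorted : sorted ltn scan_col.
Proof.
by apply: sorted_map_ltn => k h1 h2; apply: (bots_max_desc hlam hT l0); lia.
Qed.

Lemma mem_scan_col v : (v \in scan_col) = path_vals lam T l m.+1 v.
Proof.
apply/mapP/value_setP => [[k]|[t]].
  rewrite mem_iota => hk ->; exists (zeta l - k).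
  by have -> : zeta l - k < zeta l by lia.
case: ifP => // ht [<-]; exists (zeta l - t); first by rewrite mem_iota; lia.
by congr bots_max; congr scan_heights; lia.
Qed.

Let skew_data mu nu S : is_skew_shape mu nu -> skew_semistandard n mu nu S ->
  let P := to_filling mu nu S in
  [/\ nested (ncols nu) (col_len mu) (col_len nu), fills (col_len mu) (col_len nu) P,
      semistd P & entries_in n P].
Proof.
move=> hsk hS; case: (hsk) => pmu pnu _; have [h1 h2] := to_filling_semistd pmu pnu hS.
split=> //; first exact: nested_of_skew.
by apply: fills_of_skew => // c r; rewrite /to_filling; case: ifP.
Qed.

Let rightmost_col_eq mu nu S : is_skew_shape mu nu -> skew_semistandard n mu nu S ->
  0 < ncols nu ->
  cols (to_filling mu nu S) (ncols nu) = path_vals lam T l m.+1 ->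
  rightmost_col mu nu S = scan_col.
Proof.
move=> hsk hS nu0 e; have [h1 h2 h3 h4] := skew_data hsk hS; case: (hsk) => pmu pnu _.
have -> : rightmost_col mu nu S =
    col_list (to_filling mu nu S) (col_len mu) (col_len nu) (ncols nu).
  apply/eq_in_map => r; rewrite mem_iota /skew_col_len => hr.
  by rewrite /to_filling in_skewE // nu0 /=; case: ifP => //; lia.
apply: ltn_sorted_eq scan_col_sorted _; first exact: (col_list_sorted h2 h3).
by move=> v; rewrite (mem_col_list h2) // e mem_scan_col.
Qed.

Let skew_weights mu nu S : is_skew_shape mu nu -> skew_semistandard n mu nu S ->
  weights (ncols nu) n (cols (to_filling mu nu S)) = skew_col_lens mu nu.
Proof.
move=> hsk hS; have [h1 h2 h3 h4] := skew_data hsk hS.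
apply/eq_in_map => c; rewrite mem_iota => hc.
by rewrite (weight_cols h1 h2 h3 h4) //; lia.
Qed.

(** Any admissible skew tableau and the matrix obtained by moving column [l] to
    the end are extremal below the same tableau, and their last columns have
    the same length. *)
Lemma right_key_cols_unique c : right_key_cols n lam T l c -> c = scan_col.
Proof.
case=> mu [nu [S [hsk hS hr [hp hlen ->]]]].
have [h1 h2 h3 h4] := skew_data hsk hS.
have em : ncols nu = m by have := perm_size hp; rewrite !size_map !size_iota.
have m0 : 0 < ncols nu by rewrite em; lia.
apply: rightmost_col_eq => //.
have [_ _ hrs] := rectifies_raises hr h3 h4.
have sS : supported m n (cols (to_filling mu nu S)).
  by rewrite -em; apply: (supported_cols h1 h2).
rewrite em -Z_last.
apply: (last_column_unique sS supported_Z _ hrs raises_Z tab_cols_highest) => //.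
- by rewrite -em.
- by rewrite -{1}em skew_weights // weights_tab.
- move=> j j0 jm; rewrite !weight_Z; try lia.
  apply: col_len_mono; rewrite /src.
  by case: (ltnP j l) => ?; case: (ltnP j m) => ?; case: (eqVneq j m) => ?;
    case: (ltnP j.+1 l) => ?; case: (ltnP j.+1 m) => ?; case: (eqVneq j.+1 m) => ?; lia.
- rewrite weight_Z; last by case/andP: hl; lia.
  rewrite (weight_cols h1 h2 h3 h4) ?em; last by rewrite -em.
  rewrite -em -/(skew_col_len mu nu _) hlen /src.
  by have -> : (ncols nu < l) = false by [lia]; rewrite em ltnn eqxx.
Qed.

(** The columns obtained by moving column [l] to the end form a skew tableau;
    by confluence its rectification can only be the given tableau. *)
Lemma right_key_cols_ex : right_key_cols n lam T l scan_col.
Proof.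
have m0 : 0 < m by lia.
have wpos c : 0 < c <= m -> 0 < weight n Z c.
  move=> hc; rewrite weight_Z // (col_len_gt0 hlam) /src;
  by case: (ltnP c l) => ?; case: (ltnP c m) => ?; case: (eqVneq c m) => ?; lia.
have [mu [nu [S [hsk hS hZ em]]]] := skew_of_columns m0 supported_Z wpos.
have [h1 h2 h3 h4] := skew_data hsk hS.
exists mu, nu, S; split=> //.
- have [b' [Q [r1 r2 r3 r4 r5]]] := rectification_ex h1 h2 h3 h4.
  have [_ _ hQ] := rectifies_raises r1 h3 h4.
  have eQ : cols Q = tab_cols lam T.
    rewrite hZ in hQ; apply: (highest_unique supported_Z hQ raises_Z) tab_cols_highest.
    exact: (highest_straight r2 r3 r4 r5).
  rewrite em in r2.
  by rewrite -(straight_unique r2 nested_lam r3 fills_lam r4 semistd_lam r5 entries_lam eQ).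
- split.
  + by rewrite -(skew_weights hsk hS) hZ em -weights_tab.
  + have := weight_cols h1 h2 h3 h4 (c := ncols nu); rewrite em hZ => /(_ m0).
    rewrite /skew_col_len => <-; rewrite weight_Z ?m0 ?leqnn // /src.
    by have -> : (m < l) = false by [lia]; rewrite ltnn eqxx.
  + by rewrite (rightmost_col_eq hsk hS) ?em ?hZ.
Qed.

(** The scanning method: the right key consists of the ends of the paths. *)
Lemma right_keyE i : 0 < i <= zeta l -> right_key n lam T l i = y (zeta l - i) m.+1.
Proof.
move=> hi; rewrite /right_key.
rewrite (xget_unique _ right_key_cols_ex); last by move=> c; apply: right_key_cols_unique.
rewrite /scan_col (nth_map 0) ?size_iota; last lia.
by rewrite nth_iota; [congr bots_max; congr scan_heights|]; lia.
Qed.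

End RightKey.

(** * The sets A and B *)

Lemma maxval_le lam T h x : maxval lam T h <= x <->
  0 < x /\ forall i, 0 < i <= ncols lam -> 0 < h i -> T i (h i) <= x.
Proof.
have gen (s : seq (nat * nat)) : \big[maxn/1]_(b <- s) T b.1 b.2 <= x <->
    0 < x /\ forall b, b \in s -> T b.1 b.2 <= x.
  elim: s => [|b s IH]; first by rewrite big_nil; split=> [|[]].
  rewrite big_cons geq_max; split=> [/andP[hb /IH[x0 hs]]|[x0 hx]].
    by split=> // b'; rewrite in_cons => /orP[/eqP ->|/hs].
  rewrite hx ?mem_head //=; apply/IH; split=> // b' hb'; apply: hx.
  by rewrite in_cons hb' orbT.
rewrite /maxval gen; split=> -[x0 hx]; split=> //.
  move=> i hi h0; apply: (hx (i, h i)).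
  apply/mapP; exists i => //; rewrite mem_filter h0 mem_iota; lia.
move=> b /mapP[i]; rewrite mem_filter mem_iota => /andP[h0 hi] ->.
by apply: hx => //; lia.
Qed.

Section Conditions.

Variables (n : nat) (lam : seq nat) (T : nat -> nat -> nat) (p : seq nat).
Hypotheses (hlam : is_partition lam) (hT : semistandard n lam T).

Local Notation m := (ncols lam).
Local Notation zeta := (col_len lam).
Local Notation H := (scan_heights lam T).
Local Notation y l t c := (bots_max T (H l t) c).
Local Notation path_end l k := (y l (zeta l - k) m.+1).
Local Notation Y := (key lam p).

Let shapeP l k : in_shape lam l k -> [/\ 0 < l, 0 < k, k <= zeta l & l <= m].
Proof.
rewrite in_shapeE // => /and3P[k0 l0 kz]; split=> //.
by rewrite -(col_len_gt0 hlam) //; lia.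
Qed.

Let demazureE : is_demazure n lam p T <->
  forall l k, in_shape lam l k -> path_end l k <= Y l k.
Proof.
have e l k : in_shape lam l k -> right_key n lam T l k = path_end l k.
  by case/shapeP=> l0 k0 kz lm; rewrite (right_keyE hlam hT) //; lia.
by split=> h l k hlk; have := h l k hlk; rewrite e.
Qed.

Let first_height l k : 0 < l -> k <= zeta l -> H l (zeta l - k) l = k.
Proof. by move=> l0 kz; rewrite (heights_first T hlam l0); lia. Qed.

Let entry_gt l k : 0 < l -> k <= zeta l -> k <= T l k.
Proof.
move=> l0; elim: k => // k IH kz; case: (posnP k) => [->|k0].
  by have := tab_range hlam hT l0 (r := 1); lia.
by apply: leq_ltn_trans (IH _) (tab_col hlam hT l0 k0 (ltnSn k) kz); lia.
Qed.

(** The end of an EWIS is the maximum of the sequence, and [T l k] is the only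
    bottom value that m(U) leaves out. *)
Let path_end_le l k x : in_shape lam l k -> 0 < x ->
  path_end l k <= x <-> T l k <= x /\ maxval lam T (Uheights lam T l k) <= x.
Proof.
case/shapeP=> l0 k0 kz lm x0; split=> [h|[h1 /maxval_le[_ h2]]].
  split.
    apply: leq_trans h; have := le_bots_max (lam:=lam) (T:=T) (l:=l) (t:=zeta l - k) (i:=l) (c:=m.+1).
    by rewrite first_height //; apply.
  apply/maxval_le; split=> // i /andP[i0 im]; rewrite /Uheights; case: eqP => // _ hi.
  by apply: leq_trans h; apply: le_bots_max.
apply: bots_max_le => i i0 im hi; have [->|il] := eqVneq i l; first by rewrite first_height.
by have := h2 i; rewrite /Uheights (negPf il) i0 => /(_ im hi).
Qed.

Let path_ends_A :
  (forall l k, in_shape lam l k -> path_end l k <= Y l k) <->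
  (forall l k, in_shape lam l k -> Aset n lam p T l k (T l k)).
Proof.
split=> h l k hlk; have := h l k hlk; have [l0 k0 kz lm] := shapeP hlk; rewrite /Aset.
  have tr := tab_range hlam hT l0 (r := k) ltac:(lia).
  move=> hY; have Y0 : 0 < Y l k.
    apply: leq_trans hY; apply: leq_trans (_ : T l k <= _); first lia.
    have := le_bots_max (lam:=lam) (T:=T) (l:=l) (t:=zeta l - k) (i:=l) (c:=m.+1).
    by rewrite first_height //; apply.
  have [h1 h2] := (path_end_le hlk Y0).1 hY; rewrite h2 /= entry_gt // !leq_min h1 /=.
  apply/andP; split.
    rewrite /below_entry; case: eqP => [_|nk]; first by rewrite /=; lia.
    by have := tab_col hlam hT l0 k0 (ltnSn k) ltac:(lia); lia.
  rewrite /right_entry; case: eqP => [_|nl]; first lia.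
  apply: (tab_row hlam hT) => //; rewrite k0.
  have : in_shape lam l.+1 k by move: hlk; rewrite /in_shape; lia.
  by case/shapeP.
case: ifP => // hm; rewrite /= !leq_min => /and4P[_ h1 _ _].
by apply/path_end_le => //; have /maxval_le[] := hm.
Qed.

Let path_rowE j t c : 0 < j -> taken lam T j t c ->
  path_row lam T j (c, H j t c) = zeta j - t.
Proof.
move=> j0 ht; have tz := taken_lt hlam hT j0 ht.
rewrite /path_row (@eq_in_filter _ _ (pred1 (zeta j - t))).
  by rewrite filter_pred1_uniq ?iota_uniq // mem_iota; lia.
move=> i; rewrite mem_iota => hi; rewrite /scan_path /heights mem_scan /=.
apply/andP/eqP => [[/eqP e h]|->].
  by have := taken_inj hlam j0 ht h e; lia.
by have -> : zeta j - (zeta j - t) = t by [lia]; rewrite eqxx.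
Qed.

Let EvalE l k j i : 0 < j -> j < l -> l <= m -> 0 < i <= zeta j ->
  Eval lam T l k j i = y j (zeta j - i) l.
Proof.
move=> j0 jl lm hi; rewrite /Eval; have -> : (j == l) = false by lia.
have hh : 0 < H j (zeta j - i) j by rewrite first_height //; lia.
have := @last_ewis T (H j (zeta j - i)) 1 m l j ltac:(lia) jl hh => /= ->.
by have -> : minn l m.+1 = l by lia.
Qed.

Let path_end_ex j t : 0 < j <= m -> t < zeta j ->
  exists l, [/\ j <= l <= m, taken lam T j t l & T l (H j t l) = y j t m.+1].
Proof.
move=> /andP[j0 jm] ht; have gen : forall c, j <= c <= m ->
    exists l, [/\ j <= l <= m, taken lam T j t l & T l (H j t l) = y j t c.+1].
  elim=> [|c IH] hc; first lia.
  rewrite bots_max_next; last lia.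
  case hk: (taken lam T j t c.+1); first by exists c.+1.
  apply: IH; have : j != c.+1 by apply: contraFneq hk => <-; apply: (taken_first T hlam).
  by lia.
by apply: gen; lia.
Qed.

Let key_mono j i i' : zeta j <= size p -> i' <= i -> 0 < i <= zeta j -> Y j i' <= Y j i.
Proof.
move=> hz h hi; rewrite /key.
apply: (sorted_leq_nth leq_trans leqnn); rewrite ?inE ?size_sort ?size_take.
- exact: (sort_sorted leq_total).
- by case: (ltnP (zeta j) (size p)); lia.
- by case: (ltnP (zeta j) (size p)); lia.
- by lia.
Qed.

(** For each column [j] the index is the path from column [j] through (l, k).
    It lies between the bounds since the heights stay weakly decreasing along
    the columns: (l-1, k) is not removed before (l, k). *)
Let path_ends_B : (forall l k, in_shape lam l k -> path_end l k <= Y l k) ->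
  forall l k, in_shape lam l k -> Bset lam p T l k (T l k).
Proof.
move=> h l k hlk j /= /andP[j0 jl]; have [l0 k0 kz lm] := shapeP hlk.
have [e|ne] := eqVneq j l.
  exists k; first by rewrite /= /arow /brow e eqxx leqnn ltnSn.
  rewrite /Eval e eqxx /= entry_gt //=; apply: leq_trans (h l k hlk).
  have := le_bots_max (lam:=lam) (T:=T) (l:=l) (t:=zeta l - k) (i:=l) (c:=m.+1).
  by rewrite first_height //; apply.
have jl' : j < l by lia.
have [t0 [ht0 tk0]] := taken_ex hlam hT j0 jl (r := k) ltac:(lia).
have tz := taken_lt hlam hT j0 tk0.
have hz := col_len_mono lam (leq_pred l).
have [t1 [ht1 tk1]] := taken_ex hlam hT j0 (c := l.-1) (r := k) ltac:(lia) ltac:(lia).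
exists (zeta j - t0) => /=.
  apply/andP; split.
    rewrite /arow (negPf ne) -{1}ht1 path_rowE //.
    suff : t0 <= t1 by lia.
    rewrite leqNgt; apply/negP => lt; have := taken_lt_height hlam j0 tk1 lt.
    have := heights_noninc hlam hT j0 t0 (c := l.-1) ltac:(lia).
    by rewrite prednK //; lia.
  rewrite /brow (negPf ne); case: (ltnP k (zeta l)) => kl; last lia.
  have [t2 [ht2 tk2]] := taken_ex hlam hT j0 jl (r := k.+1) ltac:(lia).
  rewrite -ht2 path_rowE //; suff : t2 < t0 by lia.
  by rewrite ltnNge; apply/negP => le; have := heights_le lam T j l le; lia.
have et : zeta j - (zeta j - t0) = t0 by lia.
rewrite EvalE //; last lia.
rewrite et; have [_ _ hy] := and3P tk0; rewrite ht0 in hy; rewrite hy /=.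
have hji : in_shape lam j (zeta j - t0) by rewrite in_shapeE //; lia.
apply: leq_trans (h j _ hji); rewrite et -ht0.
by apply: le_bots_max => //; rewrite ht0.
Qed.

(** Apply the condition to the box (l, k) where the path from (j, i) ends. A
    path from row [i' > i] within the bounds is scanned earlier, when (l, k) is
    already the bottom of column [l], and arrives with a value at most
    [T l k]; it would have used the box. *)
Let B_path_ends : (forall j, zeta j <= size p) ->
  (forall l k, in_shape lam l k -> Bset lam p T l k (T l k)) ->
  forall l k, in_shape lam l k -> path_end l k <= Y l k.
Proof.
move=> hz h j i hji; have [j0 i0 iz jm] := shapeP hji.
have [||l [/andP[jl lm] hk <-]] := @path_end_ex j (zeta j - i); [lia|lia|].
set t := zeta j - i in hk *; set k := H j t l.
have hlk : in_shape lam l k.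
  by rewrite in_shapeE // heights_zeta; have [_ -> _] := and3P hk; lia.
have /= := h l k hlk j; rewrite j0 jl => /(_ isT)[i' /= hi' /andP[hE hY]].
have [ii|ii] := leqP i' i.
  by apply: leq_trans hY (key_mono (hz j) ii _); rewrite i0.
exfalso; have [e|ne] := eqVneq j l.
  have ki : k = i by rewrite /k -e first_height.
  by move: hi'; rewrite /arow /brow e eqxx ki; lia.
have jl' : j < l by lia.
have [hi2 hk'] : i' <= zeta j /\ H j (zeta j - i') l = k.
  have tt : H j t l <= H j (zeta j - i') l by apply: heights_le; rewrite /t; lia.
  move: hi'; rewrite /brow (negPf ne) => /andP[_]; case: (ltnP k (zeta l)) => kl.
    have [t2 [ht2 tk2]] := taken_ex hlam hT j0 jl (r := k.+1) ltac:(lia).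
    rewrite -ht2 path_rowE // => hi'; split; first lia.
    by have := taken_lt_height hlam j0 tk2 (t' := zeta j - i') ltac:(lia); rewrite -/k in tt; lia.
  move=> hi'; split; first lia.
  by have := heights_zeta lam T j (zeta j - i') l; rewrite -/k in tt; lia.
have hk2 : taken lam T j (zeta j - i') l.
  have [hr hp _] := and3P hk; rewrite /taken hr hk' hp /=.
  by rewrite EvalE in hE => //; lia.
by have := taken_inj hlam j0 hk hk2 (esym hk'); rewrite /t; lia.
Qed.

Lemma demazure_tfae : (forall j, zeta j <= size p) ->
  [<-> is_demazure n lam p T;
       (forall l k, in_shape lam l k -> Aset n lam p T l k (T l k));
       (forall l k, in_shape lam l k -> Bset lam p T l k (T l k))].
Proof.
move=> hz; tfae.
- by move=> /demazureE /path_ends_A.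
- by move=> /path_ends_A /path_ends_B.
- by move=> /(B_path_ends hz) /demazureE.
Qed.

End Conditions.

Theorem theorem10p1 (n : nat) (hn : 1 <= n)
    (lam : n.-tuple nat) (hlam : is_partition lam)
    (p : n.-tuple nat) (hp : is_lambda_perm lam p)
    (T : nat -> nat -> nat) (hT : semistandard n lam T) :
  [<-> is_demazure n lam p T;
       (forall l k, in_shape lam l k -> Aset n lam p T l k (T l k));
       (forall l k, in_shape lam l k -> Bset lam p T l k (T l k))].
Proof.
apply: demazure_tfae => // j; rewrite size_tuple -[X in _ <= X](size_tuple lam).
exact: count_size.
Qed.
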